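(* Let $X$ be a $2$-convex Banach sequence lattice and let $(J_m)$ be a sequence of index sets, each of degree at most $m$. Then there is a constant $C>0$ depending only on the $2$-convexity constant of $X$ such that for all $n$ and all $m$ with $\Lambda_T(m)\subset J_m$, $$C^{-m}\Big(1+\frac nm\Big)^{\frac m2}\le\boldsymbol{\lambda}\big(\mathcal{P}_{J_m}(X_n)\big)\le C^m\Big(1+\frac nm\Big)^{\frac m2}$$ and $$C^{-m}\Big(1+\frac nm\Big)^{\frac{m-1}2}\le\boldsymbol{\chi_{\mathrm{mon}}}\big(\mathcal{P}_{J_m}(X_n)\big)\le C^m\Big(1+\frac nm\Big)^{\frac{m-1}2}.$$
   Context: A Banach sequence lattice $X$ over $\mathbb{N}$ is a Banach space of complex sequences with the ideal property; $X$ is $2$-convex with constant $M^{(2)}(X)$ if $\|(\sum_k|x_k|^2)^{1/2}\|_X\le M^{(2)}(X)(\sum_k\|x_k\|_X^2)^{1/2}$ for all finite families. $X_n$ is $\mathbb{C}^n$ with $\|z\|=\|\sum_{k\le n}|z_k|e_k\|_X$. An index set is a subset of $\mathbb{N}_0^{(\mathbb{N})}$, of degree at most $m$ if $|\alpha|\le m$ for all its elements; $\Lambda_T(m)$ is the set of multi-indices with entries in $\{0,1\}$ and $|\alpha|=m$. $\mathcal{P}_J(X_n)$: polynomials $\sum_{\alpha\in J\cap\mathbb{N}_0^n}c_\alpha z^\alpha$ with sup norm over the open unit ball of $X_n$. $\boldsymbol{\lambda}$: projection constant; $\boldsymbol{\chi_{\mathrm{mon}}}$: unconditional basis constant of the monomial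 basis.
   Formalization: The space P_{J_m}(X_n) is assumed nonzero, i.e. J_m contains an index supported in the first n coordinates; otherwise (e.g. J_m = Λ_T(m) with n < m) it is the zero space and the lower bounds fail. *)

(* Defs.v *)
From HB Require Import structures.
From mathcomp Require Import all_boot all_order all_algebra.
From mathcomp Require Import all_classical all_reals.
From mathcomp Require Import exp.
From mathcomp Require Import complex.



Unset Printing Implicit Defensive.

Import Order.TTheory GRing.Theory Num.Theory.
Local Open Scope ring_scope.
Local Open Scope classical_set_scope.

Definition cabs {R : realType} (z : R[i]) : R := Normc.normc z.

Definition rC {R : realType} (x : R) : R[i] := real_complex R x.

Notation cseq R := (nat -> R[i]).

Definition unitseq {R : realType} (k : nat) : cseq R :=
  fun j => if j == k then 1 else 0.

(* A Banach sequence lattice is given by its carrier Xm (a set of      *)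
(* complex sequences) and its norm nX (only meaningful on Xm).         *)

Definition is_banach_seq_lattice {R : realType}
    (Xm : set (cseq R)) (nX : cseq R -> R) : Prop :=
  [/\
   [/\ Xm (fun _ => 0),
       (forall x y, Xm x -> Xm y -> Xm (fun k => x k + y k)) &
       (forall (a : R[i]) x, Xm x -> Xm (fun k => a * x k))],
   [/\ (forall x y, Xm x -> Xm y ->
          nX (fun k => x k + y k) <= nX x + nX y),
       (forall (a : R[i]) x, Xm x -> nX (fun k => a * x k) = cabs a * nX x)
     & (forall x, Xm x -> nX x = 0 -> x = (fun _ => 0))],
   (forall u : nat -> cseq R, (forall p, Xm (u p)) ->
      (forall e : R, 0 < e -> exists N, forall p q, (N <= p)%N -> (N <= q)%N ->
          nX (fun k => u p k - u q k) < e) ->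
      exists2 x, Xm x & forall e : R, 0 < e -> exists N, forall p,
          (N <= p)%N -> nX (fun k => u p k - x k) < e),
   (forall x y, Xm x -> (forall k, cabs (y k) <= cabs (x k)) ->
      Xm y /\ nX y <= nX x)
 & (* the unit vectors belong to X (needed for X_n to make sense) *)
   (forall k, Xm (unitseq k))].

Definition two_convex {R : realType}
    (Xm : set (cseq R)) (nX : cseq R -> R) (M : R) : Prop :=
  forall (N : nat) (x : 'I_N -> cseq R), (forall i, Xm (x i)) ->
    nX (fun k => rC (Num.sqrt (\sum_(i < N) cabs (x i k) ^+ 2)))
      <= M * Num.sqrt (\sum_(i < N) nX (x i) ^+ 2).

Definition Xn_norm {R : realType} (nX : cseq R -> R) (n : nat)
    (z : 'I_n -> R[i]) : R :=
  nX (fun k => if insub k is Some i then rC (cabs (z i)) else 0).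

Definition mindex := nat -> nat.

Definition is_mindex (a : mindex) : Prop :=
  exists N, forall k, (N <= k)%N -> a k = 0%N.

Definition index_set (J : set mindex) : Prop := forall a, J a -> is_mindex a.

(* |a| <= m  (for a finitely supported a, |a| = sum of all entries,
   i.e. the supremum of the partial sums) *)
Definition mdeg_le (m : nat) (a : mindex) : Prop :=
  forall N, (\sum_(k < N) a k <= m)%N.

Definition deg_at_most (J : set mindex) (m : nat) : Prop :=
  forall a, J a -> mdeg_le m a.

Definition LambdaT (m : nat) : set mindex :=
  [set a | (forall k, (a k <= 1)%N) /\
           exists N, (forall k, (N <= k)%N -> a k = 0%N) /\
                     (\sum_(k < N) a k)%N = m].

(* The polynomial space P_J(X_n) for an index set J of degree <= m.    *)
(* Every a in J \cap N_0^n has entries <= m, so it is represented by   *)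
(* an element of the finite type MI n m := {ffun 'I_n -> 'I_m.+1}.     *)
(* A polynomial is given by its coefficient family c : MI n m -> C,    *)
(* vanishing outside J.                                                *)

Definition MI (n m : nat) := {ffun 'I_n -> 'I_m.+1}.

Definition mi_ext {n m : nat} (a : MI n m) : mindex :=
  fun k => if insub k is Some i then nat_of_ord (a i) else 0%N.

Definition inPJ {R : realType} (J : set mindex) {n m : nat}
    (c : MI n m -> R[i]) : Prop :=
  forall a, ~ J (mi_ext a) -> c a = 0.

Definition monom {R : realType} {n m : nat} (a : MI n m)
    (z : 'I_n -> R[i]) : R[i] :=
  \prod_(i < n) z i ^+ (nat_of_ord (a i)).

Definition peval {R : realType} {n m : nat} (c : MI n m -> R[i])
    (z : 'I_n -> R[i]) : R[i] :=
  \sum_(a : MI n m) c a * monom a z.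

Definition pnorm {R : realType} (nX : cseq R -> R) {n m : nat}
    (c : MI n m -> R[i]) : R :=
  sup [set cabs (peval c z) | z in [set z | Xn_norm nX n z < 1]].

Definition chi_mon {R : realType} (nX : cseq R -> R) (J : set mindex)
    (n m : nat) : R :=
  sup [set r : R | exists (c eps : MI n m -> R[i]),
         [/\ inPJ J c, (forall a, cabs (eps a) <= 1), 0 < pnorm nX c &
             r = pnorm nX (fun a => eps a * c a) / pnorm nX c]].

Definition is_cnorm {R : realType} {Z : lmodType R[i]} (nZ : Z -> R) : Prop :=
  [/\ forall x y : Z, nZ (x + y) <= nZ x + nZ y,
      forall (a : R[i]) (x : Z), nZ (a *: x) = cabs a * nZ x
    & forall x : Z, nZ x = 0 -> x = 0].

(* relative projection constant lambda(E, Z) where E = P_J(X_n) is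
   embedded in Z by c |-> sum_a c_a *: iota a *)
Definition rel_proj_const {R : realType} (nX : cseq R -> R)
    (J : set mindex) (n m : nat) (Z : lmodType R[i]) (nZ : Z -> R)
    (iota : MI n m -> Z) : R :=
  inf [set K : R | exists P : Z -> Z,
        [/\ (forall (a : R[i]) (x y : Z), P (a *: x + y) = a *: P x + P y),
            (forall x : Z, exists2 c : MI n m -> R[i], inPJ J c &
                 P x = \sum_(a : MI n m) c a *: iota a),
            (forall c : MI n m -> R[i], inPJ J c ->
                 P (\sum_(a : MI n m) c a *: iota a)
                   = \sum_(a : MI n m) c a *: iota a) &
            (forall x : Z, nZ (P x) <= K * nZ x)]].

Definition proj_const {R : realType} (nX : cseq R -> R) (J : set mindex)
    (n m : nat) : R :=
  sup [set r : R | exists (Z : lmodType R[i]) (nZ : Z -> R)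
                          (iota : MI n m -> Z),
         [/\ is_cnorm nZ,
             (forall c : MI n m -> R[i], inPJ J c ->
                nZ (\sum_(a : MI n m) c a *: iota a) = pnorm nX c) &
             r = rel_proj_const nX J n m Z nZ iota]].

(* Main.v *)
Require Import Defs.
From HB Require Import structures.
From mathcomp Require Import all_boot all_order all_algebra.
From mathcomp Require Import all_classical all_reals.
From mathcomp Require Import sequences exp.
From mathcomp Require Import complex.
From mathcomp Require Import fingroup perm cyclic cyclotomic separable.
From mathcomp Require Import ring lra.

(** Integrals over the torus are replaced by averages over roots of unity of
    large order.  A product-maximising point of a convex hull (Lozanovskii)
    gives, on one hand, a probability measure for which the orthogonal
    projection onto the monomials of [J] (applied to Hahn-Banach extensions of
    evaluations) has norm at most [sqrt (6 #|J|)]; on the other hand, by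
    2-convexity, a point [v] of the ball with [sum |z_i / v_i|^2 = O(n)] on the
    ball.  The latter bounds [sum |(z / v)^a|^2] over the tetrahedral monomials
    by [L^2 = (n / m)^m exp (O(m))].  For the lower bound of the projection
    constant, a projection is averaged over rotations of [v] and tested on the
    bounded functions [(z / v)^a / L]; the inequality of L2 and L1 norms of
    polynomials of degree [m] makes a truncation argument work.  For the
    unconditional constant, the upper bound compares [sum |c_a z^a|] with the
    partial derivatives [z_k d_k P], and the lower bound uses
    Kahane-Salem-Zygmund polynomials [sum eps_a (z / v)^a]. *)

Import Order.TTheory GRing.Theory Num.Theory.
Local Open Scope ring_scope.
Local Open Scope classical_set_scope.

Set Implicit Arguments.
Unset Strict Implicit.

(** The ball of [X_n] is not explicit and the constant may depend on [M] alone. The only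
    quantitative contact with 2-convexity is the point [v]: it places the ball inside an ellipsoid
    with semi-axes [O(sqrt n) |v_i|]. All other losses are exponential in [m]. The gap between the
    exponents [m / 2] and [(m - 1) / 2] has two sources. In the upper bound, only monomials
    divisible by [z_k] occur in [z_k d_k P], so Cauchy-Schwarz pays for a count in degree [m - 1],
    and the sum over [k] costs nothing since [sum_k |z_k d_k P|] is bounded pointwise by the norm of
    [P]. In the lower bound, random polynomials lose [sqrt n], and [n <= m (1 + n / m)]. If [n < m],
    no tetrahedral monomial in [n] variables exists; the lower bounds then come from
    [1 + n / m <= 2] and from both constants being at least 1. *)

HB.instance Definition _ (R : realType) :=
  GRing.RMorphism.copy (@rC R) (real_complex R).

(** * Modulus of complex numbers and averages over finite sets *)

Section ComplexModulus.
Variable R : realType.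
Implicit Types (x y : R) (z w : R[i]).

Lemma cabs_ge0 z : 0 <= cabs z.
Proof. by case: z => a b; apply: sqrtr_ge0. Qed.

Lemma cabs0 : cabs (0 : R[i]) = 0.
Proof. exact: Normc.normc0. Qed.

Lemma cabs1 : cabs (1 : R[i]) = 1.
Proof. exact: Normc.normc1. Qed.

Lemma cabsM z w : cabs (z * w) = cabs z * cabs w.
Proof. exact: Normc.normcM. Qed.

Lemma cabsV z : cabs z^-1 = (cabs z)^-1.
Proof. exact: Normc.normcV. Qed.

Lemma cabsD z w : cabs (z + w) <= cabs z + cabs w.
Proof. exact: le_normcD. Qed.

Lemma cabsN z : cabs (- z) = cabs z.
Proof. exact: normcN. Qed.

Lemma cabs_eq0 z : (cabs z == 0) = (z == 0).
Proof.
apply/eqP/eqP => [/Normc.eq0_normc //|->]; exact: cabs0.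
Qed.

Lemma cabs_gt0 z : (0 < cabs z) = (z != 0).
Proof. by rewrite lt0r cabs_ge0 andbT cabs_eq0. Qed.

Lemma cabsX z n : cabs (z ^+ n) = cabs z ^+ n.
Proof. by elim: n => [|n IH]; rewrite ?expr0 ?cabs1 // !exprS cabsM IH. Qed.

Lemma cabs_sum I (r : seq I) (P : pred I) (F : I -> R[i]) :
  cabs (\sum_(i <- r | P i) F i) <= \sum_(i <- r | P i) cabs (F i).
Proof.
elim/big_rec2: _ => [|i x z _ le_z]; first by rewrite cabs0.
by apply: le_trans (cabsD _ _) _; rewrite lerD2l.
Qed.

Lemma cabs_prod I (r : seq I) (P : pred I) (F : I -> R[i]) :
  cabs (\prod_(i <- r | P i) F i) = \prod_(i <- r | P i) cabs (F i).
Proof. by apply: (big_morph cabs cabsM cabs1). Qed.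

Lemma cabs_rC x : cabs (rC x) = `|x|.
Proof. by rewrite /cabs /rC /= expr0n /= addr0 sqrtr_sqr. Qed.

Lemma cabs_rC_ge0 x : 0 <= x -> cabs (rC x) = x.
Proof. by move=> x0; rewrite cabs_rC ger0_norm. Qed.

Lemma cabs_nat n : cabs (n%:R : R[i]) = n%:R.
Proof. by rewrite -(rmorph_nat (@rC R)) cabs_rC_ge0. Qed.

Lemma cabs_conj z : cabs (conjc z) = cabs z.
Proof. by case: z => a b; rewrite /cabs /= sqrrN. Qed.

Lemma mul_conjc z : z * conjc z = rC (cabs z ^+ 2).
Proof.
by case: z => a b; rewrite /cabs /= sqr_sqrtr ?addr_ge0 ?sqr_ge0 //; apply/eqP;
  rewrite eq_complex /=; apply/andP; split; apply/eqP; ring.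
Qed.

Lemma conjcM z w : conjc (z * w) = conjc z * conjc w.
Proof. exact: rmorphM. Qed.

Lemma conjc_sum I (r : seq I) (P : pred I) (F : I -> R[i]) :
  conjc (\sum_(i <- r | P i) F i) = \sum_(i <- r | P i) conjc (F i).
Proof. exact: rmorph_sum. Qed.

Lemma conjc_rC x : conjc (rC x) = rC x.
Proof. by rewrite /rC conjc_real. Qed.

Lemma rC_inj : injective (@rC R).
Proof. exact: complexI. Qed.

Lemma Re_le_cabs z : complex.Re z <= cabs z.
Proof.
case: z => a b; rewrite /cabs /=; apply: le_trans (ler_norm _) _.
by rewrite -sqrtr_sqr ler_wsqrtr // lerDl sqr_ge0.
Qed.

Lemma Re_sum I (r : seq I) (P : pred I) (F : I -> R[i]) :
  complex.Re (\sum_(i <- r | P i) F i) = \sum_(i <- r | P i) complex.Re (F i).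
Proof. by apply: big_morph => [[a b] [c d]|]. Qed.

End ComplexModulus.

Section Average.

Definition avg (F : fieldType) (T : finType) (f : T -> F) : F :=
  (\sum_t f t) / #|T|%:R.

Variables (R : realType) (T : finType).
Hypothesis T_gt0 : (0 < #|T|)%N.

Lemma card_neq0 : (#|T|%:R : R) != 0.
Proof. by rewrite pnatr_eq0 -lt0n. Qed.

Lemma eq_avg (F : fieldType) (f g : T -> F) : f =1 g -> avg f = avg g.
Proof. by move=> e; rewrite /avg (eq_bigr _ (fun i _ => e i)). Qed.

Lemma avgZ (F : fieldType) a (f : T -> F) : avg (fun t => a * f t) = a * avg f.
Proof. by rewrite /avg -mulr_sumr mulrA. Qed.

Lemma avg_suml (F : fieldType) I (r : seq I) (P : pred I) (f : I -> T -> F) :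
  avg (fun t => \sum_(i <- r | P i) f i t) = \sum_(i <- r | P i) avg (f i).
Proof. by rewrite /avg exchange_big mulr_suml. Qed.

Lemma avgD (F : fieldType) (f g : T -> F) :
  avg (fun t => f t + g t) = avg f + avg g.
Proof. by rewrite /avg big_split mulrDl. Qed.

Lemma avg_cst (x : R) : avg (fun _ : T => x) = x.
Proof. by rewrite /avg sumr_const -[x *+ _]mulr_natr mulfK ?card_neq0. Qed.

Lemma ler_avg (f g : T -> R) : (forall t, f t <= g t) -> avg f <= avg g.
Proof. by move=> fg; rewrite ler_wpM2r ?invr_ge0 // ler_sum. Qed.

Lemma avg_ge0 (f : T -> R) : (forall t, 0 <= f t) -> 0 <= avg f.
Proof. by move=> f0; rewrite mulr_ge0 ?invr_ge0 // sumr_ge0. Qed.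

Lemma rC_avg (f : T -> R) : rC (avg f) = avg (fun t => rC (f t)).
Proof. by rewrite /avg rmorphM fmorphV rmorph_sum rmorph_nat. Qed.

Lemma cabs_avg (f : T -> R[i]) : cabs (avg f) <= avg (fun t => cabs (f t)).
Proof. by rewrite /avg cabsM cabsV cabs_nat ler_wpM2r ?invr_ge0 // cabs_sum. Qed.

Lemma exists_le_avg (f : T -> R) : exists t, f t <= avg f.
Proof.
apply/existsP; rewrite -[X in is_true X]negbK negb_exists; apply/negP => /forallP lt.
have: avg f < avg f; last by rewrite ltxx.
rewrite {2}/avg ltr_pdivlMr ?ltr0n // mulr_natr -sumr_const.
have /card_gt0P [t0 _] := T_gt0.
apply: ltr_sum; last by move=> t _; move: (lt t); rewrite -ltNge.
by apply/hasP; exists t0; rewrite ?mem_index_enum.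
Qed.

End Average.

(** * Finite groups of rotations: orthogonality of characters, Parseval, Bessel *)

Section RootsOfUnity.
Variable R : realType.

Lemma exists_primitive_root N : exists z : R[i], (N.+1).-primitive_root z.
Proof.
have [r def] := closed_field_poly_normal ('X^(N.+1) - 1 : {poly R[i]}).
have mon : ('X^(N.+1) - 1 : {poly R[i]}) \is monic by rewrite monicXnsubC.
rewrite (monicP mon) scale1r in def.
have rootsP z : root (\prod_(u <- r) ('X - u%:P)) z = (z \in r).
  exact: root_prod_XsubC.
have unity : all (N.+1).-unity_root r.
  by apply/allP => z zr; rewrite /root_of_unity def rootsP.
have sz : size r = N.+1.
  by have := size_prod_XsubC r id; rewrite -def size_XnsubC // => -[].
have uq : uniq r.
  have : separable_poly (\prod_(u <- r) ('X - u%:P)).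
    rewrite -def separable_Xn_sub_1 //.
    by rewrite pnatr_eq0.
  by rewrite separable_prod_XsubC.
have /hasP [z _ zP] := has_prim_root (ltn0Sn N) unity uq (eq_leq (esym sz)).
by exists z.
Qed.

Definition zeta N : R[i] := sval (cid (exists_primitive_root N)).

Lemma zetaP N : (N.+1).-primitive_root (zeta N).
Proof. exact: svalP (cid (exists_primitive_root N)). Qed.

Lemma cabs_zeta N : cabs (zeta N) = 1.
Proof.
have := congr1 cabs (prim_expr_order (zetaP N)).
by rewrite cabsX cabs1 => /eqP; rewrite pexpr_eq1 ?cabs_ge0 // => /eqP.
Qed.

(** For [a != b] this is a geometric sum with ratio [r], and [r] differs from 1 because both
    exponents lie below the order [N.+1]. *)
Lemma sum_zeta N a b : (a <= N)%N -> (b <= N)%N ->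
  \sum_(j < N.+1) (zeta N ^+ j) ^+ a * conjc ((zeta N ^+ j) ^+ b)
    = (N.+1)%:R *+ (a == b).
Proof.
move=> aN bN.
have E j : zeta N ^+ j * conjc (zeta N ^+ j) = 1.
  by rewrite mul_conjc cabsX cabs_zeta !expr1n rmorph1.
case: eqVneq => [<-|ab]; rewrite ?mulr0n ?mulr1n.
  rewrite (eq_bigr (fun _ => 1)) ?sumr_const ?card_ord // => j _.
  by rewrite -!exprM E.
pose r := zeta N ^+ a * conjc (zeta N ^+ b).
have -> : \sum_(j < N.+1) (zeta N ^+ j) ^+ a * conjc ((zeta N ^+ j) ^+ b)
    = \sum_(j < N.+1) r ^+ j.
  by apply: eq_bigr => j _; rewrite exprMn -rmorphXn -!exprM (mulnC a) (mulnC b).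
have r1 : r - 1 != 0.
  rewrite subr_eq0; apply: contra ab => /eqP r1.
  have : zeta N ^+ a == zeta N ^+ b.
    by rewrite -[X in _ == X]mul1r -r1 /r -mulrA [conjc _ * _]mulrC E mulr1.
  by rewrite (eq_prim_root_expr (zetaP N)) !modn_small.
apply: (mulfI r1); rewrite mulr0 -subrX1 /r exprMn -rmorphXn -!exprM.
rewrite !(mulnC _ N.+1) !(exprM (zeta N) N.+1) (prim_expr_order (zetaP N)) !expr1n.
by rewrite rmorph1 mulr1 subrr.
Qed.

Variables (I : finType) (N : nat).
Implicit Types (th : {ffun I -> 'I_N.+1}) (e : I -> nat).

Definition rot th (i : I) : R[i] := zeta N ^+ th i.

Definition chi e th : R[i] := \prod_i rot th i ^+ e i.

Lemma cabs_rot th i : cabs (rot th i) = 1.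
Proof. by rewrite cabsX cabs_zeta expr1n. Qed.

Lemma cabs_chi e th : cabs (chi e th) = 1.
Proof.
rewrite cabs_prod; apply: big1 => i _.
by rewrite cabsX cabs_rot expr1n.
Qed.

Lemma card_rot_gt0 : (0 < #|{ffun I -> 'I_N.+1}|)%N.
Proof. by rewrite card_ffun card_ord expn_gt0. Qed.

(** The bounds on the exponents exclude aliasing modulo [N.+1]. Each application chooses [N]
    accordingly: [m] for a polynomial, [2 m] for its square, [p] for words of length [p]. *)
Lemma chi_orthogonal e e' : (forall i, (e i <= N)%N) -> (forall i, (e' i <= N)%N) ->
  avg (fun th => chi e th * conjc (chi e' th)) = [forall i, e i == e' i]%:R.
Proof.
move=> eN eN'; rewrite /avg.
under eq_bigr => th _ do rewrite rmorph_prod -big_split /=.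
rewrite -(bigA_distr_bigA (fun (i : I) (j : 'I_N.+1) =>
  (zeta N ^+ j) ^+ e i * conjc ((zeta N ^+ j) ^+ e' i))).
under eq_bigr => i _ do rewrite sum_zeta //.
rewrite card_ffun card_ord natrX.
case: forallP => [ee|]; last first.
  move/forallP; rewrite negb_forall => /existsP [i /negPf ne].
  by rewrite (bigD1 i) //= ne mulr0n !mul0r.
rewrite (eq_bigr (fun _ => (N.+1)%:R)) => [|i _]; last by rewrite (eqP (ee i)) eqxx.
by rewrite prodr_const divff // expf_neq0 // pnatr_eq0.
Qed.

Lemma chiM e e' th : chi e th * chi e' th = chi (fun i => (e i + e' i)%N) th.
Proof.
by rewrite /chi -big_split; apply: eq_bigr => i _; rewrite exprD.
Qed.

Lemma parseval_expand (T : finType) (e : T -> I -> nat) (x : T -> R[i]) :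
  (forall t i, (e t i <= N)%N) ->
  rC (avg (fun th => cabs (\sum_t x t * chi (e t) th) ^+ 2)) =
  \sum_t \sum_(t' | [forall i, e t i == e t' i]) x t * conjc (x t').
Proof.
move=> eN; rewrite rC_avg.
under eq_avg => th.
  rewrite -mul_conjc rmorph_sum mulr_suml.
  under eq_bigr => t _.
    rewrite mulr_sumr.
    under eq_bigr => t' _ do rewrite rmorphM mulrACA.
    over.
  over.
rewrite avg_suml; apply: eq_bigr => t _.
rewrite avg_suml [RHS]big_mkcond; apply: eq_bigr => t' _.
by rewrite avgZ chi_orthogonal //; case: ifP; rewrite ?mulr1 ?mulr0.
Qed.

Lemma parseval (T : finType) (e : T -> I -> nat) (x : T -> R[i]) :
  (forall t i, (e t i <= N)%N) -> (forall t t', e t =1 e t' -> t = t') ->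
  avg (fun th => cabs (\sum_t x t * chi (e t) th) ^+ 2) = \sum_t cabs (x t) ^+ 2.
Proof.
move=> eN e_inj; apply: rC_inj; rewrite parseval_expand // rmorph_sum.
apply: eq_bigr => t _; rewrite /= -mul_conjc (big_pred1 t) // => t'.
apply/forallP/eqP => [ee|-> //]; apply/esym/e_inj => i; exact/eqP.
Qed.

(** Indices with equal exponents interact, but [|x y| <= (x^2 + y^2) / 2] bounds the cross terms, so
    the size of a fibre is the whole loss. This serves for powers of polynomials, where products of
    monomials collide. *)
Lemma parseval_le (T : finType) (e : T -> I -> nat) (x : T -> R[i]) D :
  (forall t i, (e t i <= N)%N) ->
  (forall t, x t != 0 -> (#|[pred t' | [forall i, e t i == e t' i]]| <= D)%N) ->
  avg (fun th => cabs (\sum_t x t * chi (e t) th) ^+ 2)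
    <= D%:R * \sum_t cabs (x t) ^+ 2.
Proof.
move=> eN cardD; set A := avg _.
pose eq t t' := [forall i, e t i == e t' i].
have eqC t t' : eq t t' = eq t' t.
  by apply/forallP/forallP => h i; rewrite eq_sym.
have -> : A = complex.Re (rC A) by [].
rewrite parseval_expand // Re_sum.
have leD t : \sum_(t' | eq t t') cabs (x t) ^+ 2 <= D%:R * cabs (x t) ^+ 2.
  rewrite sumr_const -[X in X <= _]mulr_natl.
  have [->|x0] := eqVneq (x t) 0; first by rewrite cabs0 expr0n !mulr0.
  by rewrite ler_wpM2r ?sqr_ge0 // ler_nat; apply: cardD.
apply: (@le_trans _ _ (\sum_t \sum_(t' | eq t t')
   (cabs (x t) ^+ 2 / 2 + cabs (x t') ^+ 2 / 2))).
  apply: ler_sum => t _; rewrite Re_sum; apply: ler_sum => t' _.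
  apply: le_trans (Re_le_cabs _) _; rewrite cabsM cabs_conj.
  by have := sqr_ge0 (cabs (x t) - cabs (x t')); nra.
under eq_bigr => t _ do rewrite big_split.
rewrite big_split /= mulr_sumr.
rewrite [X in _ + X](exchange_big_dep xpredT) //=.
rewrite -big_split /=; apply: ler_sum => t _.
under [X in _ + X]eq_bigl => t' do rewrite eqC.
by rewrite -big_split /= (le_trans _ (leD t)) //; apply: ler_sum => t' _; lra.
Qed.

End RootsOfUnity.

(** The orthogonal projection [g] of [f] satisfies [<f, g> = <g, f> = <g, g> = s], so that
    [<f - g, f - g> = <f, f> - s]. Here [u a] is the squared norm of [psi a] for the weights [p]. *)
Lemma bessel (R : realType) (W A : finType) (S : {set A}) (p : W -> R)
    (f : W -> R[i]) (psi : A -> W -> R[i]) (u : A -> R) :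
  (forall w, 0 <= p w) -> (forall a, a \in S -> 0 < u a) ->
  (forall a b, a \in S -> b \in S ->
     \sum_w rC (p w) * (psi a w * conjc (psi b w)) = rC (u a) *+ (a == b)) ->
  \sum_(a in S) cabs (\sum_w rC (p w) * (f w * conjc (psi a w))) ^+ 2 / u a
    <= \sum_w p w * cabs (f w) ^+ 2.
Proof.
move=> p0 u0 orth.
pose ip (f g : W -> R[i]) := \sum_w rC (p w) * (f w * conjc (g w)).
pose c a := ip f (psi a) / rC (u a).
have u_neq0 a : a \in S -> rC (u a) != 0.
  by move=> aS; rewrite fmorph_eq0 gt_eqF ?u0.
pose g w := \sum_(a in S) c a * psi a w.
pose s : R := \sum_(a in S) cabs (ip f (psi a)) ^+ 2 / u a.
have cE a : a \in S -> rC (cabs (ip f (psi a)) ^+ 2 / u a)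
    = c a * conjc (ip f (psi a)).
  move=> aS; rewrite /c [RHS]mulrAC -/(ip f (psi a)).
  by have := mul_conjc (ip f (psi a)) => /= ->; rewrite rmorphM fmorphV.
have sE : rC s = \sum_(a in S) c a * conjc (ip f (psi a)).
  by rewrite rmorph_sum; apply: eq_bigr => a /cE.
have ipgf : ip g f = rC s.
  rewrite sE /ip /g.
  under eq_bigr => w _ do rewrite mulr_suml mulr_sumr.
  rewrite exchange_big; apply: eq_bigr => a aS /=.
  rewrite conjc_sum mulr_sumr; apply: eq_bigr => w _.
  by rewrite !conjcM conjcK conjc_rC; ring.
have ipC h k : ip h k = conjc (ip k h).
  rewrite /ip conjc_sum; apply: eq_bigr => w _.
  by rewrite !conjcM conjcK conjc_rC; ring.
have ipfg : ip f g = rC s by rewrite ipC ipgf conjc_rC.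
have ipgg : ip g g = rC s.
  transitivity (\sum_(a in S) conjc (c a) * ip g (psi a)).
    rewrite {1}/ip; under eq_bigr => w _ do rewrite conjc_sum !mulr_sumr.
    rewrite exchange_big; apply: eq_bigr => a aS /=.
    rewrite /ip mulr_sumr; apply: eq_bigr => w _.
    by rewrite conjcM; ring.
  rewrite sE; apply: eq_bigr => a aS.
  have -> : ip g (psi a) = c a * rC (u a).
    rewrite {1}/ip /g; under eq_bigr => w _ do rewrite mulr_suml mulr_sumr.
    rewrite exchange_big.
    have F b : b \in S -> \sum_w rC (p w) * (c b * psi b w * conjc (psi a w))
        = c b * (rC (u b) *+ (b == a)).
      by move=> bS; rewrite -orth // mulr_sumr; apply: eq_bigr => w _; ring.
    rewrite (eq_bigr _ F) (bigD1 a) //= eqxx mulr1n -[RHS]addr0; congr (_ + _).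
    by apply: big1 => b /andP[_ /negPf ->]; rewrite mulr0n mulr0.
  have cu : ip f (psi a) = c a * rC (u a) by rewrite /c divfK ?u_neq0.
  by rewrite [in RHS]cu conjcM conjc_rC; ring.
have ge0 : 0 <= \sum_w p w * cabs (f w - g w) ^+ 2.
  by apply: sumr_ge0 => w _; rewrite mulr_ge0 ?sqr_ge0.
rewrite -subr_ge0; apply: le_trans ge0 _; rewrite le_eqVlt; apply/orP; left.
apply/eqP/rC_inj; rewrite rmorphB /= -/s.
have fE h : rC (\sum_w p w * cabs (h w) ^+ 2) = ip h h.
  by rewrite rmorph_sum; apply: eq_bigr => w _; rewrite rmorphM mul_conjc.
rewrite !fE.
have -> : ip (fun w => f w - g w) (fun w => f w - g w)
   = ip f f - ip f g - ip g f + ip g g.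
  rewrite /ip -!sumrB -big_split; apply: eq_bigr => w _ /=.
  by rewrite rmorphB /=; ring.
by rewrite ipfg ipgf ipgg subrK.
Qed.

(** * Elementary inequalities and the product-maximising point *)

Section RealInequalities.
Variable R : realType.

Lemma cauchy_schwarz (I : finType) (P : pred I) (x y : I -> R) :
  (\sum_(i | P i) x i * y i) ^+ 2
    <= (\sum_(i | P i) x i ^+ 2) * (\sum_(i | P i) y i ^+ 2).
Proof.
have : 0 <= \sum_(i | P i) \sum_(j | P j) (x i * y j - x j * y i) ^+ 2.
  by apply: sumr_ge0 => i _; apply: sumr_ge0 => j _; apply: sqr_ge0.
have -> : \sum_(i | P i) \sum_(j | P j) (x i * y j - x j * y i) ^+ 2 =
    \sum_(i | P i) \sum_(j | P j)
      (x i ^+ 2 * y j ^+ 2 + y i ^+ 2 * x j ^+ 2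
       - 2 * ((x i * y i) * (x j * y j))).
  by apply: eq_bigr => i _; apply: eq_bigr => j _; ring.
under eq_bigr => i _ do rewrite sumrB big_split -!mulr_sumr /=.
rewrite sumrB big_split -!mulr_suml -mulr_sumr -mulr_suml /=.
by rewrite expr2; lra.
Qed.

Lemma cauchy_schwarz_sqrt (I : finType) (P : pred I) (x y : I -> R) :
  \sum_(i | P i) x i * y i
    <= Num.sqrt (\sum_(i | P i) x i ^+ 2) * Num.sqrt (\sum_(i | P i) y i ^+ 2).
Proof.
have s0 (f : I -> R) : 0 <= \sum_(i | P i) f i ^+ 2.
  by apply: sumr_ge0 => i _; apply: sqr_ge0.
rewrite -sqrtrM //; apply: le_trans (ler_norm _) _.
by rewrite -sqrtr_sqr ler_wsqrtr // cauchy_schwarz.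
Qed.

Lemma prod_ge1D_sum (I : finType) (x : I -> R) : (forall i, 0 <= x i) ->
  1 + \sum_i x i <= \prod_i (1 + x i).
Proof.
move=> x0; suff [] : 1 + \sum_i x i <= \prod_i (1 + x i) /\ 0 <= \sum_i x i by [].
elim/big_rec2: _ => [|i s p _ [le s0]]; first by rewrite addr0.
split; last by rewrite addr_ge0.
by have := x0 i; have := mulr_ge0 (x0 i) s0; nra.
Qed.

Lemma bernoulli_1B (x : R) d : 0 <= x <= 1 -> 1 - d%:R * x <= (1 - x) ^+ d.
Proof.
move=> /andP[x0 x1]; elim: d => [|d IH]; first by rewrite mul0r subr0.
rewrite exprS -natr1; have d0 : 0 <= (d%:R : R) by [].
apply: le_trans (_ : (1 - x) * (1 - d%:R * x) <= _).
  by have := mulr_ge0 d0 (sqr_ge0 x); nra.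
by rewrite ler_wpM2l // subr_ge0.
Qed.

(* A point of the convex hull of the vectors [F z], [z] in [B], whose product
   of coordinates is at least half the supremum works as [u]. *)
Lemma lozanovskii (U : Type) (T : finType) (B : set U) (F : U -> T -> R) (D : R) :
  (0 < #|T|)%N -> (forall z t, B z -> 0 <= F z t <= D) ->
  (exists z, B z /\ forall t, 0 < F z t) ->
  exists N (nu : 'I_N -> R) (z : 'I_N -> U),
    [/\ forall j, 0 <= nu j, forall j, B (z j), \sum_j nu j = 1,
        forall t, 0 < \sum_j nu j * F (z j) t &
        forall y, B y -> \sum_t F y t / (\sum_j nu j * F (z j) t) <= 6 * #|T|%:R].
Proof.
move=> T0 F0D [y0 [By0 Fy0]].
pose valid N (nu : 'I_N -> R) (z : 'I_N -> U) :=
  [/\ forall j, 0 <= nu j, forall j, B (z j) & \sum_j nu j = 1].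
pose u N (nu : 'I_N -> R) (z : 'I_N -> U) t := \sum_j nu j * F (z j) t.
have F0 z t : B z -> 0 <= F z t by move=> /(F0D _ t) /andP[].
have uge0 N (nu : 'I_N -> R) z t : valid N nu z -> 0 <= u N nu z t.
  by case=> nu0 Bz _; apply: sumr_ge0 => j _; rewrite mulr_ge0 ?F0.
pose E : set R := [set x | exists N nu z, valid N nu z /\ x = \prod_t u N nu z t].
pose x0 := \prod_t F y0 t.
have x0_gt0 : 0 < x0 by apply: prodr_gt0.
have Ex0 : E x0.
  exists 1%N, (fun=> 1), (fun=> y0); split; last first.
    by apply: eq_bigr => t _; rewrite /u big_ord1 mul1r.
  by split=> //; rewrite big_ord1.
have ubE : ubound E (D ^+ #|T|).
  move=> _ [N [nu [z [vld ->]]]]; rewrite -prodr_const; apply: ler_prod => t _.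
  rewrite uge0 //=; case: vld => nu0 Bz nu1.
  rewrite -[D]mul1r -nu1 mulr_suml; apply: ler_sum => j _.
  by rewrite ler_wpM2l //; case/andP: (F0D _ t (Bz j)).
have hsE : has_sup E by split; [exists x0 | exists (D ^+ #|T|)].
have le_sup x : E x -> x <= sup E by apply: ub_le_sup; exists (D ^+ #|T|).
have supE_gt0 : 0 < sup E by apply: lt_le_trans x0_gt0 (le_sup _ Ex0).
(* A product within a factor 2 of the supremum replaces the maximum; this factor is the bound on [q]
   below. *)
have [|_ [N [nu [z [vld ->]]]] ltp] := sup_adherent (_ : 0 < sup E / 2) hsE.
  by rewrite divr_gt0.
have p_gt0 : 0 < \prod_t u N nu z t by lra.
have u_gt0 t : 0 < u N nu z t.
  rewrite lt0r uge0 // andbT; apply: contraTneq p_gt0 => ut0.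
  by rewrite (bigD1 t) //= ut0 mul0r ltxx.
have [nu0 Bz nu1] := vld.
exists N, nu, z; split=> // y By.
have d0 : 0 < (#|T|%:R : R) by rewrite ltr0n.
have d1 : 1 <= (#|T|%:R : R) by rewrite ler1n.
(* Moving [u] towards [F y] by the fraction [dl] multiplies the product by [q <= 2]. With
   [dl = 1 / (2 d)], Bernoulli gives [(1 - dl)^d >= 1/2], whence [1 + dl * sum r <= 4] and the
   constant 6. *)
set d : R := #|T|%:R in d0 d1 *; pose dl := (2 * d)^-1.
have dl0 : 0 < dl by rewrite invr_gt0 mulr_gt0.
have dldE : d * dl = 2^-1 by rewrite /dl; field; rewrite gt_eqF.
have dl1 : dl <= 1 by have := mulr_ge0 (ltW dl0) (ltW d0); nra.
pose r t := F y t / u N nu z t.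
have r0 t : 0 <= r t by rewrite divr_ge0 ?F0 // ltW.
pose nu' (j : 'I_N.+1) := if unlift ord0 j is Some k then (1 - dl) * nu k else dl.
pose z' (j : 'I_N.+1) := if unlift ord0 j is Some k then z k else y.
have vld' : valid N.+1 nu' z'.
  split=> [j|j|].
  - by rewrite /nu'; case: unliftP => [k _|_]; rewrite ?mulr_ge0 ?subr_ge0 // ltW.
  - by rewrite /z'; case: unliftP.
  - rewrite big_ord_recl /nu' unlift_none.
    under eq_bigr => j _ do rewrite liftK.
    by rewrite -mulr_sumr nu1 mulr1 addrC subrK.
have u'E t : u N.+1 nu' z' t = u N nu z t * ((1 - dl) + dl * r t).
  rewrite {1}/u big_ord_recl /nu' /z' unlift_none.
  under eq_bigr => j _ do rewrite liftK -mulrA.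
  rewrite -mulr_sumr -/(u N nu z t) /r; field.
  by rewrite gt_eqF.
have : \prod_t u N.+1 nu' z' t <= sup E.
  by apply: le_sup; exists N.+1, nu', z'.
rewrite (eq_bigr _ (fun t _ => u'E t)) big_split /=.
set p := \prod_t u N nu z t in ltp p_gt0 *; set q := \prod_t (_ + _) => leq.
have q2 : q <= 2.
  by rewrite -(ler_pM2l p_gt0); lra.
have qge : 2^-1 * (1 + dl * \sum_t r t) <= q.
  apply: le_trans (_ : \prod_t ((1 - dl) * (1 + dl * r t)) <= _).
    rewrite big_split prodr_const /= ler_pM //.
    - by rewrite invr_ge0.
    - by rewrite addr_ge0 // mulr_ge0 ?sumr_ge0 // ltW.
    - apply: le_trans (bernoulli_1B #|T| _); last by rewrite dl1 ltW.
      by rewrite -/d dldE; lra.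
    - by rewrite mulr_sumr; apply: prod_ge1D_sum => t; rewrite mulr_ge0 // ltW.
  apply: ler_prod => t _; have := mulr_ge0 (ltW dl0) (r0 t) => h.
  rewrite mulr_ge0 ?subr_ge0 ?addr_ge0 //=.
  by have := mulr_ge0 h (ltW dl0); nra.
have h : dl * \sum_t r t <= 3 by lra.
change (\sum_t r t <= 6 * d).
have -> : 6 * d = 3 / dl by rewrite /dl; field; rewrite gt_eqF.
by rewrite ler_pdivlMr // mulrC.
Qed.

End RealInequalities.

(** * Counting monomials; comparison of L1, L2 and L4 norms on the torus *)

Section Monomials.
Variable R : realType.

Definition mdeg n m (a : MI n m) : nat := \sum_i a i.

Definition expo n m (a : MI n m) : 'I_n -> nat := fun i => a i.

Lemma expo_inj n m (a b : MI n m) : expo a =1 expo b -> a = b.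
Proof. by move=> ab; apply/ffunP => i; apply/val_inj/ab. Qed.

Lemma expo_le n m (a : MI n m) i : (expo a i <= m)%N.
Proof. by rewrite -ltnS; apply: ltn_ord. Qed.

Lemma monom_rot n m N (a : MI n m) (z : 'I_n -> R[i]) (th : {ffun 'I_n -> 'I_N.+1}) :
  monom a (fun i => z i * rot R th i) = monom a z * chi R (expo a) th.
Proof.
by rewrite /monom /chi -big_split; apply: eq_bigr => i _; rewrite exprMn.
Qed.

Lemma cabs_monom n m (a : MI n m) (z : 'I_n -> R[i]) :
  cabs (monom a z) = \prod_i cabs (z i) ^+ a i.
Proof. by rewrite cabs_prod; apply: eq_bigr => i _; rewrite cabsX. Qed.

(** Generating function bound: each counted [a] has [x ^+ k <= x ^+ mdeg a], and the sum of
    [x ^+ mdeg a] over all of [MI n m] is a product of [n] truncated geometric series. *)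
Lemma card_mdeg_le n m k (x : R) : 0 < x < 1 ->
  #|[pred a : MI n m | (mdeg a <= k)%N]|%:R * x ^+ k <= (1 - x)^-1 ^+ n.
Proof.
move=> /andP[x0 x1]; have x1' : 0 < 1 - x by rewrite subr_gt0.
rewrite mulr_natl -sumr_const.
apply: (@le_trans _ _ (\sum_(a : MI n m) \prod_i x ^+ a i)).
  rewrite [X in X <= _]big_mkcond; apply: ler_sum => a _.
  case: ifP => [ak|_]; last by apply: prodr_ge0 => i _; rewrite exprn_ge0 // ltW.
  by rewrite prodrXr ler_wiXn2l // ltW.
rewrite -(bigA_distr_bigA (fun (i : 'I_n) (j : 'I_m.+1) => x ^+ j)).
rewrite prodr_const card_ord; apply: lerXn2r.
- by rewrite nnegrE sumr_ge0 // => j _; rewrite exprn_ge0 // ltW.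
- by rewrite nnegrE invr_ge0 ltW.
rewrite -[_^-1]mul1r ler_pdivlMr // mulrC -opprB mulNr -subrX1 opprB.
by rewrite lerBlDr lerDl exprn_ge0 // ltW.
Qed.

Lemma card_mdeg_le_exp n m k : (0 < n)%N -> (0 < m)%N ->
  (#|[pred a : MI n m | (mdeg a <= k)%N]|%:R : R)
    <= (1 + n%:R / m%:R) ^+ k * expR m%:R.
Proof.
move=> n0 m0.
have n0' : 0 < (n%:R : R) by rewrite ltr0n.
have m0' : 0 < (m%:R : R) by rewrite ltr0n.
have nm0 : 0 < (n%:R : R) + m%:R by rewrite addr_gt0.
(* This choice gives [x^-1 = 1 + n / m] and [(1 - x)^-1 = 1 + m / n], whose [n]-th power is at most
   [exp m]. *)
pose x : R := m%:R / (n%:R + m%:R).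
have x0 : 0 < x by rewrite divr_gt0.
have x1 : x < 1 by rewrite ltr_pdivrMr // mul1r ltrDr.
have := @card_mdeg_le n m k x; rewrite x0 x1 => /(_ isT) h.
have -> : 1 + n%:R / m%:R = x^-1 :> R.
  by rewrite /x; field; rewrite ?gt_eqF.
rewrite exprVn mulrC ler_pdivlMr ?exprn_gt0 // (le_trans h) //.
have -> : (1 - x)^-1 = 1 + m%:R / n%:R.
  rewrite /x; field; rewrite ?gt_eqF //=.

have -> : expR (m%:R : R) = expR (m%:R / n%:R) ^+ n.
  by rewrite -expRM_natl; congr expR; field; rewrite gt_eqF.
by apply: lerXn2r; rewrite ?nnegrE ?expR_ge0 ?expR_ge1Dx // addr_ge0 // divr_ge0.
Qed.

Lemma card_ord_le m g : (#|[pred j : 'I_m.+1 | (j <= g)%N]| <= g.+1)%N.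
Proof.
rewrite -[X in (_ <= X)%N](card_ord g.+1) -(@card_in_imset _ _ (fun j : 'I_m.+1 => inord j : 'I_g.+1)).
  exact: max_card.
move=> i j; rewrite !inE => ig jg /(congr1 val); rewrite /= !inordK //.
exact: val_inj.
Qed.

(** A splitting is determined by its first component, which is bounded coordinatewise by
    [g = a + b]; this leaves at most [prod (g_i + 1) <= prod 2^g_i] choices. *)
Lemma card_splittings n m (a b : MI n m) :
  (#|[pred p : MI n m * MI n m | [forall i, expo a i + expo b i == expo p.1 i + expo p.2 i]]|
     <= 2 ^ (mdeg a + mdeg b))%N.
Proof.
set A := [pred p | _].
pose F (i : 'I_n) := [pred j : 'I_m.+1 | (j <= a i + b i)%N].
have inj : {in A &, injective (fun p : MI n m * MI n m => p.1)}.
  move=> [p p'] [q q']; rewrite !inE /= => /forallP hp /forallP hq e; subst q.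
  congr (_, _); apply: expo_inj => i; apply/eqP.
  by rewrite -(eqn_add2l (expo p i)) -(eqP (hp i)) (eqP (hq i)).
rewrite -(card_in_imset inj).
apply: (@leq_trans #|family F|).
  apply: subset_leq_card; apply/fintype.subsetP => _ /imsetP[p pA ->].
  apply/familyP => i; move: pA; rewrite !inE => /forallP /(_ i) /eqP.
  by rewrite /expo => ->; rewrite leq_addr.
rewrite card_family foldrE big_map big_enum /= /mdeg -big_split expn_sum /=.
apply: leq_prod => i _; apply: leq_trans (card_ord_le _ _) _.
exact: ltn_expl.
Qed.

Variables (n m N : nat) (c : MI n m -> R[i]).
Hypotheses (N2m : (m + m <= N)%N) (cdeg : forall a, c a != 0 -> (mdeg a <= m)%N).

Let f (th : {ffun 'I_n -> 'I_N.+1}) := \sum_a c a * chi R (expo a) th.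

Lemma expo_leN (a : MI n m) i : (expo a i <= N)%N.
Proof. exact: leq_trans (expo_le _ _) (leq_trans (leq_addr _ _) N2m). Qed.

Lemma avg_sqr_chi : avg (fun th => cabs (f th) ^+ 2) = \sum_a cabs (c a) ^+ 2.
Proof. by apply: parseval => [a|]; [apply: expo_leN | apply: expo_inj]. Qed.

(** Parseval for the square of [f]: each of its coefficients collects at most [4 ^ m] nonzero
    products [c a * c b]. *)
Lemma avg_L4_le : avg (fun th => cabs (f th) ^+ 4)
  <= 4 ^+ m * (\sum_a cabs (c a) ^+ 2) ^+ 2.
Proof.
pose x (p : MI n m * MI n m) := c p.1 * c p.2.
pose e (p : MI n m * MI n m) i := (expo p.1 i + expo p.2 i)%N.
have -> : avg (fun th => cabs (f th) ^+ 4) = avg (fun th : {ffun (ordinal n) -> (ordinal N.+1)} =>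
    cabs (\sum_p x p * chi R (e p) th) ^+ 2).
  apply: eq_avg => th; rewrite (_ : 4 = 2 * 2)%N // exprM -[cabs _ ^+ 2]cabsX.
  congr (cabs _ ^+ 2); rewrite expr2 /f mulr_suml.
  under eq_bigr => a _ do rewrite mulr_sumr.
  rewrite pair_big; apply: eq_bigr => -[a b] _ /=.
  by rewrite mulrACA chiM.
apply: le_trans (@parseval_le R _ N _ e x (4 ^ m) _ _) _.
- move=> p i; apply: leq_trans (leq_add (expo_le _ _) (expo_le _ _)) N2m.
- move=> [a b]; rewrite /x /= mulf_eq0 negb_or => /andP[/cdeg am /cdeg bm].
  apply: leq_trans (card_splittings a b) _.
  by rewrite (_ : 4 = 2 ^ 2)%N // -expnM leq_exp2l // mul2n -addnn leq_add.
rewrite natrX ler_wpM2l ?exprn_ge0 // [X in _ <= X]expr2 mulr_suml.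
under [X in _ <= X]eq_bigr => a _ do rewrite mulr_sumr.
rewrite [X in _ <= X]pair_big /= le_eqVlt; apply/orP; left; apply/eqP.
by apply: eq_bigr => -[a b] _; rewrite /x cabsM exprMn.
Qed.

Lemma l2_le_avg : Num.sqrt (\sum_a cabs (c a) ^+ 2)
  <= 4 * 2 ^+ m * avg (fun th => cabs (f th)).
Proof.
set s := \sum_a _; set E1 := avg _.
have s0 : 0 <= s by apply: sumr_ge0 => a _; apply: sqr_ge0.
have E10 : 0 <= E1 by apply: avg_ge0 => th; apply: cabs_ge0.
have [s00|sn0] := eqVneq s 0.
  by rewrite s00 sqrtr0; apply: mulr_ge0 => //; rewrite mulr_ge0 // exprn_ge0.
have s_gt0 : 0 < s by rewrite lt0r sn0.
set q := Num.sqrt s; have q_gt0 : 0 < q by rewrite sqrtr_gt0.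
have qq : q ^+ 2 = s by rewrite sqr_sqrtr.
(* Below height [l] use [y^2 <= l y], above it [y^2 <= l^-2 y^4]. This [l] makes the bound on the L4
   term equal to [s / 4], which the left-hand side absorbs. *)
pose l := 2 * 2 ^+ m * q.
have l0 : 0 < l by rewrite !mulr_gt0 // exprn_gt0.
have le_s : s <= l * E1 + s / 4.
  apply: le_trans (_ : avg (fun th => cabs (f th) ^+ 2) <= _).
    by rewrite avg_sqr_chi.
  apply: (@le_trans _ _ (avg (fun th => l * cabs (f th) + l^-1 ^+ 2 * cabs (f th) ^+ 4))).
    apply: ler_avg => th; have := cabs_ge0 (f th); set y := cabs _ => y0.
    have l2 : 0 < l ^+ 2 by rewrite exprn_gt0.
    case: (leP y l) => yl.
      have : 0 <= l^-1 ^+ 2 * y ^+ 4 by rewrite mulr_ge0 // exprn_ge0 // invr_ge0 ltW.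
      by have := mulr_ge0 y0 (_ : 0 <= l - y); rewrite subr_ge0 => /(_ yl); nra.
    have : y ^+ 2 <= l^-1 ^+ 2 * y ^+ 4.
      rewrite exprVn mulrC ler_pdivlMr // (_ : 4 = 2 + 2)%N // exprD.
      by rewrite ler_wpM2l ?sqr_ge0 // ler_pXn2r ?nnegrE // ltW.
    by have := mulr_ge0 (ltW l0) y0; lra.
  rewrite avgD !avgZ lerD2l.
  apply: le_trans (ler_wpM2l _ avg_L4_le) _; first by rewrite exprn_ge0 // invr_ge0 ltW.
  rewrite -/s /l !exprVn !exprMn qq -exprM mulnC exprM (_ : 2 ^+ 2 = 4 :> R); last by ring.
  rewrite le_eqVlt; apply/orP; left; apply/eqP; field.
  by rewrite ?sn0 ?expf_neq0 ?pnatr_eq0 //.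
have : q * q <= 4 * 2 ^+ m * E1 * q.
  rewrite -expr2 qq; move: le_s; rewrite /l.
  set t := _ * q * E1; have -> : 4 * 2 ^+ m * E1 * q = 2 * t by rewrite /t; ring.
  by lra.
by rewrite ler_pM2r.
Qed.

End Monomials.

(** * Polynomials on the ball of a lattice norm; Cauchy estimates *)

Section LatticeNorm.
Variables (R : realType) (n : nat).

(** This is the interface through which [X_n] enters the estimates. Solidity makes the ball
    invariant under rotations of the coordinates, on which all averaging arguments rest. *)
Definition lattice_norm (q : ('I_n -> R[i]) -> R) : Prop :=
  [/\ forall y z, (forall i, cabs (y i) <= cabs (z i)) -> q y <= q z,
      forall a z, q (fun i => a * z i) = cabs a * q z &
      forall i, 0 < q (fun j => (j == i)%:R)].

Variable q : ('I_n -> R[i]) -> R.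
Hypothesis q_norm : lattice_norm q.

Lemma norm_solid y z : (forall i, cabs (y i) <= cabs (z i)) -> q y <= q z.
Proof. by case: q_norm => + _ _; apply. Qed.

Lemma norm_scale a z : q (fun i => a * z i) = cabs a * q z.
Proof. by case: q_norm. Qed.

Lemma norm_ge0 z : 0 <= q z.
Proof.
have -> : 0 = q (fun i => 0 * z i) by rewrite norm_scale cabs0 mul0r.
by apply: norm_solid => i; rewrite mul0r cabs0 cabs_ge0.
Qed.

Lemma norm0 : q (fun=> 0) = 0.
Proof.
have -> : (fun=> 0) = (fun i : 'I_n => 0 * (0 : R[i])) by rewrite mul0r.
by rewrite norm_scale cabs0 mul0r.
Qed.

Lemma ball_rot N z (th : {ffun 'I_n -> 'I_N.+1}) :
  q z < 1 -> q (fun i => z i * rot R th i) < 1.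
Proof.
by apply: le_lt_trans; apply: norm_solid => i; rewrite cabsM cabs_rot mulr1.
Qed.

(** Solidity gives [|z_i| q(e_i) <= q z]. The size of [D] never enters the final constants; it only
    keeps suprema finite. *)
Lemma ball_bounded : exists2 D, 1 <= D & forall z, q z < 1 -> forall i, cabs (z i) <= D.
Proof.
pose f i := (q (fun j => (j == i)%:R))^-1.
have f0 i : 0 < f i by case: q_norm => _ _ h; rewrite invr_gt0.
have s0 : 0 <= \sum_i f i by apply: sumr_ge0 => i _; apply: ltW.
exists (1 + \sum_i f i); first by rewrite lerDl.
move=> z z1 i; apply: (@le_trans _ _ (f i)).
  rewrite -[f i]mul1r ler_pdivlMr; last by rewrite -invr_gt0; apply: f0.
  apply: le_trans (ltW z1); rewrite -norm_scale; apply: norm_solid => j.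
  by case: eqVneq => [->|_]; rewrite ?mulr1 ?mulr0 ?cabs0 ?cabs_ge0.
rewrite (bigD1 i) //= addrCA lerDl addr_ge0 //.
by apply: sumr_ge0 => j _; apply: ltW.
Qed.

Lemma exists_positive_point : exists2 t : R, 0 < t & q (fun=> rC t) < 1.
Proof.
pose t := (1 + q (fun=> 1))^-1.
have h : 0 < 1 + q (fun=> 1) by apply: ltr_wpDr (norm_ge0 _) ltr01.
have t0 : 0 < t by rewrite invr_gt0.
exists t => //.
have -> : (fun=> rC t) = (fun i : 'I_n => rC t * 1) by apply/funext => i; rewrite mulr1.
rewrite norm_scale cabs_rC_ge0 ?(ltW t0) // /t mulrC ltr_pdivrMr // mul1r.
by rewrite ltrDr.
Qed.

Variable m : nat.
Implicit Types (c : MI n m -> R[i]) (z : 'I_n -> R[i]).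

Definition supnorm c : R := sup [set cabs (peval c z) | z in [set z | q z < 1]].

Lemma peval_bounded c : exists K, forall z, q z < 1 -> cabs (peval c z) <= K.
Proof.
have [D D1 zD] := ball_bounded.
exists (\sum_a cabs (c a) * \prod_(i < n) D ^+ a i) => z z1.
apply: le_trans (cabs_sum _ _ _) _; apply: ler_sum => a _.
rewrite cabsM cabs_monom ler_wpM2l ?cabs_ge0 //; apply: ler_prod => i _.
rewrite exprn_ge0 ?cabs_ge0 //= lerXn2r ?nnegrE ?cabs_ge0 ?zD //.
exact: le_trans ler01 D1.
Qed.

Lemma has_ubound_peval c :
  has_ubound [set cabs (peval c z) | z in [set z | q z < 1]].
Proof.
by have [K cK] := peval_bounded c; exists K => _ [z z1 <-]; apply: cK.
Qed.

Lemma peval_le_supnorm c z : q z < 1 -> cabs (peval c z) <= supnorm c.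
Proof. by move=> z1; apply: ub_le_sup; [exact: has_ubound_peval | exists z]. Qed.

Lemma supnorm_le c K :
  (forall z, q z < 1 -> cabs (peval c z) <= K) -> supnorm c <= K.
Proof.
move=> cK; apply: ge_sup; last by move=> _ [z z1 <-]; apply: cK.
by exists (cabs (peval c (fun=> 0))); exists (fun=> 0); rewrite //= norm0.
Qed.

Lemma supnorm_ge0 c : 0 <= supnorm c.
Proof.
apply: le_trans (cabs_ge0 (peval c (fun=> 0))) _.
by apply: peval_le_supnorm; rewrite norm0.
Qed.

Lemma peval_rot N c z (th : {ffun 'I_n -> 'I_N.+1}) :
  peval c (fun i => z i * rot R th i)
    = \sum_a (c a * monom a z) * chi R (expo a) th.
Proof. by apply: eq_bigr => a _; rewrite monom_rot mulrA. Qed.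

(** Discrete Cauchy formula: averaging against a character isolates one term of the polynomial. *)
Lemma avg_peval N c z b : (m <= N)%N ->
  avg (fun th : {ffun 'I_n -> 'I_N.+1} =>
     peval c (fun i => z i * rot R th i) * conjc (chi R (expo b) th))
    = c b * monom b z.
Proof.
move=> mN; have eN (a : MI n m) i : (expo a i <= N)%N by apply: leq_trans mN; apply: expo_le.
under eq_avg => th.
  rewrite peval_rot mulr_suml.
  under eq_bigr => a _ do rewrite -mulrA.
  over.
rewrite avg_suml (bigD1 b) //= avgZ chi_orthogonal //.
rewrite (_ : [forall i, _]) ?mulr1; last by apply/forallP.
rewrite big1 ?addr0 // => a ab; rewrite avgZ chi_orthogonal //.
case: forallP => [e|]; last by rewrite mulr0.
by case/negP: ab; apply/eqP/expo_inj => i; apply/eqP.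
Qed.

Lemma coef_le_supnorm c z b : q z < 1 -> cabs (c b) * cabs (monom b z) <= supnorm c.
Proof.
move=> z1; rewrite -cabsM -(avg_peval c z b (leqnn m)).
apply: le_trans (cabs_avg _) _.
rewrite -[X in _ <= X](avg_cst (card_rot_gt0 'I_n m)).
apply: ler_avg => th; rewrite cabsM cabs_conj cabs_chi mulr1.
by apply: peval_le_supnorm; apply: ball_rot.
Qed.

Lemma supnorm_gt0 c b : c b != 0 -> 0 < supnorm c.
Proof.
move=> cb; have [t t0 t1] := exists_positive_point.
apply: lt_le_trans (coef_le_supnorm c b t1).
rewrite mulr_gt0 ?cabs_gt0 // /monom prodf_seq_neq0; apply/allP => i _ /=.
by rewrite expf_neq0 // fmorph_eq0 gt_eqF.
Qed.

End LatticeNorm.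

(** * Upper bound for the multipliers of monomial coefficients *)

Section OneVariable.
Variable R : realType.

Lemma coef_avg N (p : {poly R[i]}) k : (size p <= N.+1)%N -> (k <= N)%N ->
  p`_k = avg (fun j : 'I_N.+1 => p.[zeta R N ^+ j] * conjc ((zeta R N ^+ j) ^+ k)).
Proof.
move=> sp kN; rewrite /avg.
under eq_bigr => j _ do rewrite (horner_coef_wide _ sp) mulr_suml.
rewrite exchange_big (bigD1 (Ordinal (kN : (k < N.+1)%N))) //=.
under eq_bigr => j _ do rewrite -mulrA.
rewrite -mulr_sumr sum_zeta // eqxx mulr1n big1 ?addr0 => [|i ik].
  by rewrite card_ord mulfK // pnatr_eq0.
under eq_bigr => j _ do rewrite -mulrA.
rewrite -mulr_sumr sum_zeta //; last by rewrite -ltnS.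
by move: ik; rewrite -val_eqE /= => /negPf ->; rewrite mulr0n mulr0.
Qed.

(** With constant term 1 the linear coefficient is a logarithmic derivative at 0, hence additive
    under products, as is the degree bound. *)
Let jet d (p : {poly R[i]}) s := [/\ p`_0 = 1, p`_1 = s & (size p <= d.+1)%N].

Let jet1 : jet 0 1 0.
Proof. by split; rewrite ?coef1 ?size_poly1. Qed.

Let jetM d p s e r t : jet d p s -> jet e r t -> jet (d + e) (p * r) (s + t).
Proof.
move=> [p0 p1 sp] [r0 r1 sr]; split.
- by rewrite coef0M p0 r0 mulr1.
- by rewrite coefM !big_ord_recl big_ord0 /= p0 p1 r0 r1 mul1r mulr1 addr0 addrC.
- apply: leq_trans (size_polyMleq _ _) _.
  rewrite -subn1 leq_subLR; apply: leq_trans (leq_add sp sr) _.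
  by rewrite addnS addSn add1n.
Qed.

Lemma coef1_prod_linear (I : finType) (a : I -> nat) (th : I -> R[i]) :
  let p := \prod_i (1 + th i *: 'X) ^+ a i in
  p`_1 = \sum_i (a i)%:R * th i /\ (size p <= (\sum_i a i).+1)%N.
Proof.
suff [_ ? ?] : jet (\sum_i a i) (\prod_i (1 + th i *: 'X) ^+ a i)
  (\sum_i (a i)%:R * th i) by [].
elim/big_rec3: _ => // i s p d _ h; apply: jetM => // {h}.
have lin : jet 1 (1 + th i *: 'X) (th i).
  split; rewrite ?coefD ?coef1 ?coefZ ?coefX /= ?mulr0 ?addr0 ?mulr1 ?add0r //.
  rewrite addrC; apply: leq_trans (size_polyD _ _) _.
  rewrite geq_max size_poly1 andbT; apply: leq_trans (size_scale_leq _ _) _.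
  by rewrite size_polyX.
elim: (a i) => [|k IH]; first by rewrite expr0 mul0r.
have -> : k.+1%:R * th i = th i + k%:R * th i by rewrite -natr1 mulrDl mul1r addrC.
by rewrite exprS; exact: (jetM lin IH).
Qed.

End OneVariable.

Section MonomialUnconditionality.
Variables (R : realType) (n m : nat) (q : ('I_n -> R[i]) -> R).
Hypothesis q_norm : lattice_norm q.
Variable c : MI n m -> R[i].
Hypothesis cdeg : forall a, c a != 0 -> (mdeg a <= m)%N.

(* The sum is the derivative at 0 of [l |-> P((1 + l th_k) z_k w_k)], with
   [th_k] chosen to make every summand nonnegative. *)
Lemma sum_partial_le_supnorm N (z : 'I_n -> R[i]) (w : {ffun 'I_n -> 'I_N.+1}) :
  q (fun i => 2 * z i) < 1 ->
  \sum_k cabs (\sum_(a : MI n m) (((a k)%:R * c a) * monom a z) * chi R (expo a) w)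
    <= supnorm q c.
Proof.
move=> z1.
pose f k := \sum_(a : MI n m) (((a k)%:R * c a) * monom a z) * chi R (expo a) w.
have [th thP] : exists th : 'I_n -> R[i],
    forall k, cabs (th k) = 1 /\ th k * f k = rC (cabs (f k)).
  have h k : exists t : R[i], cabs t = 1 /\ t * f k = rC (cabs (f k)).
    have [->|f0] := eqVneq (f k) 0.
      by exists 1; rewrite cabs1 cabs0 mulr0 rmorph0.
    have nf0 : rC (cabs (f k)) != 0 by rewrite fmorph_eq0 cabs_eq0.
    exists (conjc (f k) / rC (cabs (f k))); split.
      by rewrite cabsM cabsV cabs_conj cabs_rC_ge0 ?cabs_ge0 // divff // cabs_eq0.
    by rewrite mulrAC [conjc _ * _]mulrC mul_conjc expr2 rmorphM /= mulfK.
  by exists (fun k => sval (cid (h k))) => k; apply: (svalP (cid (h k))).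
pose g (a : MI n m) := (c a * monom a z) * chi R (expo a) w.
pose P (a : MI n m) : {poly R[i]} := \prod_k (1 + th k *: 'X) ^+ expo a k.
pose p : {poly R[i]} := \sum_a g a *: P a.
have p1 : p`_1 = rC (\sum_k cabs (f k)).
  rewrite coef_sum rmorph_sum /=.
  under [RHS]eq_bigr => k _ do rewrite -(proj2 (thP k)) mulr_sumr.
  rewrite exchange_big; apply: eq_bigr => a _ /=.
  rewrite coefZ (proj1 (coef1_prod_linear _ _)) mulr_sumr.
  by apply: eq_bigr => k _; rewrite /g /expo; ring.
(* One more than the degree requires: [coef_avg] is then used with [N = m.+1], for which the index 1
   is admissible even if [m = 0]. *)
have sp : (size p <= m.+2)%N.
  apply: leq_trans (size_sum _ _ _) _; apply/bigmax_leqP => a _.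
  have [ca|ca] := eqVneq (c a) 0; first by rewrite /g ca !mul0r scale0r size_poly0.
  apply: leq_trans (size_scale_leq _ _) _.
  apply: leq_trans (proj2 (coef1_prod_linear _ _)) _.
  by rewrite ltnS; apply: leq_trans (cdeg ca) _.
have pE l : p.[l] = peval c (fun k => z k * rot R w k * (1 + l * th k)).
  rewrite horner_sum; apply: eq_bigr => a _.
  rewrite hornerZ /g -!mulrA; congr (_ * _); rewrite mulrA -monom_rot /P horner_prod.
  rewrite /monom -big_split; apply: eq_bigr => k _ /=.
  by rewrite horner_exp !hornerE -exprMn (mulrC l).
have -> : \sum_k cabs (f k) = cabs p`_1.
  by rewrite p1 cabs_rC_ge0 // sumr_ge0 // => k _; apply: cabs_ge0.
rewrite (coef_avg sp) //; apply: le_trans (cabs_avg _) _.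
have c0 : (0 < #|'I_m.+2|)%N by rewrite card_ord.
rewrite -[X in _ <= X](avg_cst c0); apply: ler_avg => j.
rewrite cabsM cabs_conj !cabsX cabs_zeta !expr1n mulr1 pE.
apply: peval_le_supnorm => //; apply: le_lt_trans z1.
(* On the unit circle [|1 + l th_k| <= 2], which is why [2 z] has to lie in the ball. *)
apply: (norm_solid q_norm) => k; rewrite !cabsM cabs_rot mulr1 mulrC.
rewrite ler_wpM2r ?cabs_ge0 // cabs_nat; apply: le_trans (cabsD _ _) _.
by rewrite cabs1 cabsM cabsX cabs_zeta expr1n (proj1 (thP k)) mulr1; lra.
Qed.

(** Division by [z_k] is injective on the monomials that contain [z_k]. *)
Lemma card_mdeg_pos_le k :
  (#|[pred a : MI n m | (0 < a k)%N && (mdeg a <= m)%N]|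
     <= #|[pred a : MI n m | (mdeg a <= m.-1)%N]|)%N.
Proof.
pose pr (a : MI n m) : MI n m := [ffun i => if i == k then inord (a i).-1 else a i].
have prE a i : pr a i = (a i - (i == k))%N :> nat.
  rewrite ffunE; case: eqP => _; rewrite ?subn0 // inordK ?subn1 //.
  by apply: leq_ltn_trans (leq_pred _) _.
have inj : {in [pred a : MI n m | (0 < a k)%N && (mdeg a <= m)%N] &, injective pr}.
  move=> a b; rewrite !inE => /andP[ak _] /andP[bk _] ab; apply: expo_inj => i.
  have := congr1 (fun x : MI n m => nat_of_ord (x i)) ab; rewrite /= !prE /expo.
  case: eqVneq => [->|_]; last by rewrite !subn0.
  by rewrite !subn1; move: ak bk; case: (nat_of_ord (a k)) (nat_of_ord (b k)) => [|x] [|y] // _ _ /= ->.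
rewrite -(card_in_imset inj); apply: subset_leq_card.
apply/fintype.subsetP => _ /imsetP[a + ->]; rewrite !inE => /andP[ak am].
rewrite -ltnS; apply: (@leq_trans (mdeg a)); last first.
  by apply: leq_trans am _; case: (m).
rewrite /mdeg (bigD1 k) //= [X in (_ <= X)%N](bigD1 k) //= prE eqxx subn1.
rewrite -addSn prednK // leq_add2l; apply: leq_sum => i ik.
by rewrite prE leq_subr.
Qed.

Let cnt := #|[pred a : MI n m | (mdeg a <= m.-1)%N]|.

(** For each [k], Cauchy-Schwarz over the monomials containing [z_k] leads to an L2 norm, which is
    then replaced by an L1 norm: averages of moduli can be summed over [k] under the average, where
    [sum_partial_le_supnorm] bounds the sum at every rotation. *)
Lemma sum_mdeg_le_supnorm (z : 'I_n -> R[i]) : q (fun i => 2 * z i) < 1 ->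
  \sum_a (mdeg a)%:R * (cabs (c a) * cabs (monom a z))
    <= Num.sqrt cnt%:R * (4 * 2 ^+ m) * supnorm q c.
Proof.
move=> z1; pose d k (a : MI n m) := ((a k)%:R * c a) * monom a z.
have -> : \sum_a (mdeg a)%:R * (cabs (c a) * cabs (monom a z))
    = \sum_k \sum_a cabs (d k a).
  rewrite exchange_big; apply: eq_bigr => a _ /=.
  rewrite natr_sum mulr_suml; apply: eq_bigr => k _.
  by rewrite /d !cabsM cabs_nat mulrA.
pose T := {ffun 'I_n -> 'I_(m + m).+1}.
apply: (@le_trans _ _ (\sum_k Num.sqrt cnt%:R * (4 * 2 ^+ m) *
   avg (fun w : T => cabs (\sum_a d k a * chi R (expo a) w)))).
  apply: ler_sum => k _.
  have ddeg a : d k a != 0 -> (mdeg a <= m)%N.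
    by rewrite /d !mulf_eq0 !negb_or -andbA => /and3P[_ /cdeg].
  rewrite -mulrA; apply: le_trans _ (ler_wpM2l (sqrtr_ge0 _) (l2_le_avg (leqnn _) ddeg)).
  pose Q := [pred a : MI n m | (0 < a k)%N && (mdeg a <= m)%N].
  have -> : \sum_a cabs (d k a) = \sum_(a | Q a) 1 * cabs (d k a).
    rewrite [RHS]big_mkcond; apply: eq_bigr => a _; case: ifP; rewrite ?mul1r //=.
    move/negbT; rewrite negb_and -leqNgt leqn0 => /orP[/eqP a0|am].
      by rewrite /d a0 !mul0r cabs0.
    by apply/eqP; rewrite cabs_eq0; apply: contraNT am => /ddeg.
  apply: le_trans (cauchy_schwarz_sqrt _ _ _) _.
  rewrite ler_pM ?sqrtr_ge0 // ler_wsqrtr //.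
    under eq_bigr => a _ do rewrite expr1n.
    by rewrite sumr_const ler_nat; apply: card_mdeg_pos_le.
  by rewrite [X in X <= _]big_mkcond; apply: ler_sum => a _; case: ifP; rewrite ?sqr_ge0.
rewrite -mulr_sumr ler_wpM2l //.
  by rewrite !mulr_ge0 ?sqrtr_ge0 ?exprn_ge0.
rewrite -avg_suml -[X in _ <= X](avg_cst (card_rot_gt0 'I_n (m + m))).
by apply: ler_avg => w; apply: sum_partial_le_supnorm.
Qed.

Lemma sum_coef_le_supnorm (z : 'I_n -> R[i]) : q z < 1 ->
  \sum_a cabs (c a) * cabs (monom a z)
    <= (1 + 2 ^+ m * (Num.sqrt cnt%:R * (4 * 2 ^+ m))) * supnorm q c.
Proof.
move=> z1; pose y i := 2^-1 * z i.
have y1 : q (fun i => 2 * y i) < 1.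
  by congr (_ < 1): z1; congr q; apply/funext => i; rewrite /y mulrA divff ?mul1r ?pnatr_eq0.
(* The constant term has weight 0 in [sum_mdeg_le_supnorm] and is bounded by the Cauchy estimate;
   all other weights are at least 1. Passing from [z] to [z / 2] costs at most [2 ^+ m]. *)
pose a0 : MI n m := [ffun=> ord0].
rewrite (bigD1 a0) //= mulrDl mul1r lerD ?coef_le_supnorm //.
rewrite -[X in _ <= X]mulrA.
apply: le_trans _ (ler_wpM2l (exprn_ge0 _ (ler0n _ 2)) (sum_mdeg_le_supnorm y1)).
rewrite mulr_sumr big_mkcond; apply: ler_sum => a _.
have r0 (b : MI n m) (x : 'I_n -> R[i]) : 0 <= cabs (c b) * cabs (monom b x).
  by rewrite mulr_ge0 ?cabs_ge0.
case: ifP => [aa0|_]; last by rewrite mulr_ge0 ?exprn_ge0 // mulr_ge0.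
have [->|ca] := eqVneq (c a) 0; first by rewrite cabs0 !mul0r !mulr0.
have d1 : 1 <= ((mdeg a)%:R : R).
  rewrite ler1n lt0n; apply: contra aa0; rewrite /mdeg sum_nat_eq0 => /forallP h.
  by apply/eqP/ffunP => i; apply/val_inj; rewrite ffunE /=; apply/eqP/(h i).
apply: (@le_trans _ _ (2 ^+ m * (cabs (c a) * cabs (monom a y)))); last first.
  by rewrite ler_wpM2l ?exprn_ge0 // ler_peMl.
rewrite mulrCA ler_wpM2l ?cabs_ge0 //.
have -> : cabs (monom a z) = 2 ^+ mdeg a * cabs (monom a y).
  rewrite !cabs_monom -prodrXr -big_split; apply: eq_bigr => i _ /=.
  by rewrite -exprMn /y cabsM cabsV cabs_nat mulrA divff ?mul1r ?pnatr_eq0.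
by rewrite ler_wpM2r ?cabs_ge0 // ler_weXn2l ?cdeg // ler1n.
Qed.

Lemma multiplier_supnorm_le (eps : MI n m -> R[i]) : (forall a, cabs (eps a) <= 1) ->
  supnorm q (fun a => eps a * c a)
    <= (1 + 2 ^+ m * (Num.sqrt cnt%:R * (4 * 2 ^+ m))) * supnorm q c.
Proof.
move=> eps1; apply: supnorm_le => // z z1.
apply: le_trans _ (sum_coef_le_supnorm z1).
apply: le_trans (cabs_sum _ _ _) _; apply: ler_sum => a _.
by rewrite !cabsM ler_wpM2r ?cabs_ge0 // ler_piMl ?cabs_ge0.
Qed.

End MonomialUnconditionality.

(** * The complex Hahn-Banach theorem, through minimal sublinear functionals *)

Section HahnBanach.
Variables (R : realType) (Z : lmodType R[i]).
Implicit Types (p : Z -> R) (x y : Z) (r s t : R).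

Let sublinear p := (forall x y, p (x + y) <= p x + p y) /\
  (forall r x, 0 <= r -> p (rC r *: x) <= r * p x).

Let sublin0 p : sublinear p -> p 0 = 0.
Proof.
move=> [pD pZ]; apply/eqP; rewrite eq_le; apply/andP; split.
  by have := pZ 0 0 (lexx 0); rewrite scaler0 mul0r.
by have := pD 0 0; rewrite addr0; lra.
Qed.

Let sublin_geN p x : sublinear p -> - p (- x) <= p x.
Proof. by move=> sp; have := sp.1 x (- x); rewrite subrr (sublin0 sp); lra. Qed.

Let sublinZ p r x : sublinear p -> 0 <= r -> p (rC r *: x) = r * p x.
Proof.
move=> sp; rewrite le_eqVlt => /orP[/eqP <-|r0].
  by rewrite rmorph0 scale0r mul0r sublin0.
apply/eqP; rewrite eq_le sp.2 ?(ltW r0) //=.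
have := sp.2 r^-1 (rC r *: x); rewrite scalerA -rmorphM mulVf ?gt_eqF //.
by rewrite rmorph1 scale1r invr_ge0 ltW // => /(_ isT); rewrite ler_pdivlMl.
Qed.

Let minimal p := sublinear p /\
  forall p', sublinear p' -> (forall x, p' x <= p x) -> p' = p.

(** The functional [p'] is sublinear and lies below [p] (take [t = 0]), so it equals [p]; then
    [t = 1] gives [p x + p y <= p (x + y)]. *)
Let minimal_additive p x y : minimal p -> p (x + y) = p x + p y.
Proof.
move=> [sp pmin]; pose A x := [set p (x + rC t *: y) - t * p y | t in [set t | 0 <= t]].
have lbA x' : has_lbound (A x').
  exists (- p (- x')) => _ [t t0 <-]; rewrite -(sublinZ _ sp) //.
  by have := sp.1 (x' + rC t *: y) (- x'); rewrite addrAC subrr add0r; lra.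
pose p' x := inf (A x).
have infA x' t : 0 <= t -> p' x' <= p (x' + rC t *: y) - t * p y.
  by move=> t0; apply: ge_inf => //; exists t.
have infA_ge x' K : (forall t, 0 <= t -> K <= p (x' + rC t *: y) - t * p y) -> K <= p' x'.
  move=> h; apply: lb_le_inf; last by move=> _ [t t0 <-]; apply: h.
  by exists (p (x' + rC 0 *: y) - 0 * p y); exists 0 => //=.
have sp' : sublinear p'.
  split=> [x1 x2|r x1].
    rewrite -lerBlDr; apply: (infA_ge) => t t0; rewrite lerBlDr -lerBlDl.
    apply: (infA_ge) => s s0; rewrite lerBlDl.
    apply: le_trans (infA _ (t + s) (addr_ge0 t0 s0)) _.
    rewrite rmorphD scalerDl addrACA.
    by have := sp.1 (x1 + rC t *: y) (x2 + rC s *: y); lra.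
  rewrite le_eqVlt => /orP[/eqP <-|r0].
    rewrite rmorph0 scale0r mul0r; apply: le_trans (infA 0 0 _) _ => //.
    by rewrite rmorph0 scale0r addr0 mul0r (sublin0 sp) subr0.
  rewrite -ler_pdivrMl //; apply: (infA_ge) => t t0; rewrite ler_pdivrMl //.
  apply: le_trans (infA _ (r * t) _) _; first by rewrite mulr_ge0 // ltW.
  by rewrite rmorphM -scalerA -scalerDr (sublinZ _ sp) ?(ltW r0) // mulrBr mulrA.
have e : p' = p.
  apply: pmin => // x'; apply: le_trans (infA x' 0 _) _ => //.
  by rewrite rmorph0 scale0r addr0 mul0r subr0.
apply/eqP; rewrite eq_le sp.1 /=.
by have := infA x 1 ler01; rewrite e rmorph1 scale1r mul1r; lra.
Qed.

Let minimalN p x : minimal p -> p (- x) = - p x.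
Proof.
move=> mp; have := minimal_additive x (- x) mp.
by rewrite subrr (sublin0 mp.1); lra.
Qed.

Let minimalZ p r x : minimal p -> p (rC r *: x) = r * p x.
Proof.
move=> mp; case: (leP 0 r) => r0; first exact: sublinZ mp.1 _.
rewrite -[r]opprK rmorphN scaleNr minimalN // sublinZ ?mulNr ?mp.1 //.
- by case: mp.
- by rewrite oppr_ge0 ltW.
Qed.

(** Zorn for the reversed pointwise order: a chain is bounded by its pointwise infimum, which is
    finite because [- p0 (- x)] lies below every member at [x]. *)
Let exists_minimal p0 : sublinear p0 ->
  exists2 p, minimal p & forall x, p x <= p0 x.
Proof.
move=> sp0; pose T := {p : Z -> R | sublinear p /\ forall x, p x <= p0 x}.
pose rel (p r : T) := `[< forall x, sval r x <= sval p x >].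
have [||||[p [sp pp0]] pmin] := @Zorn T rel.
- by move=> p; apply/asboolP.
- move=> p r s /asboolP pr /asboolP rs; apply/asboolP => x.
  exact: le_trans (rs x) (pr x).
- move=> [p hp] [r hr] /asboolP /= pr /asboolP /= rp; apply: eq_exist => /=.
  by apply/funext => x; apply/eqP; rewrite eq_le pr rp.
- move=> A totA; have [[p1 Ap1]|A0] := pselect (exists p1 : T, A p1); last first.
    exists (exist _ p0 (conj sp0 (fun x => lexx _))) => s As.
    by case: A0; exists s.
  pose V x := [set sval p x | p in A].
  have V0 x : V x !=set0 by exists (sval p1 x); exists p1.
  have lbV x : has_lbound (V x).
    exists (- p0 (- x)) => _ [[p [sp pp0]] _ <-] /=.
    by apply: le_trans (sublin_geN x sp); rewrite lerN2.
  pose pi x := inf (V x).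
  have pi_le x (p : T) : A p -> pi x <= sval p x.
    by move=> Ap; apply: ge_inf => //; exists p.
  have pi_ge x K : (forall p : T, A p -> K <= sval p x) -> K <= pi x.
    by move=> h; apply: lb_le_inf => // _ [p Ap <-]; apply: h.
  have spi : sublinear pi.
    split=> [x y|r x r0].
      rewrite -lerBlDr; apply: (pi_ge) => p Ap; rewrite lerBlDr -lerBlDl.
      apply: (pi_ge) => r Ar; rewrite lerBlDl.
      have [/asboolP pr|/asboolP rp] := totA p r Ap Ar.
        apply: le_trans (pi_le (x + y) r Ar) _.
        by apply: le_trans ((svalP r).1.1 x y) _; rewrite lerD2r.
      apply: le_trans (pi_le (x + y) p Ap) _.
      by apply: le_trans ((svalP p).1.1 x y) _; rewrite lerD2l.
    move: r0; rewrite le_eqVlt => /orP[/eqP <-|r0].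
      rewrite rmorph0 scale0r mul0r; apply: le_trans (pi_le 0 p1 Ap1) _.
      by rewrite (sublin0 (svalP p1).1).
    rewrite -ler_pdivrMl //; apply: (pi_ge) => p Ap; rewrite ler_pdivrMl //.
    apply: le_trans (pi_le _ p Ap) _.
    by rewrite ((svalP p).1.2 r x (ltW r0)).
  have pip0 x : pi x <= p0 x by apply: le_trans (pi_le x p1 Ap1) ((svalP p1).2 x).
  exists (exist _ pi (conj spi pip0)) => s As; apply/asboolP => x /=.
  exact: pi_le.
exists p => //; split=> // r sr rp.
have rp0 x : r x <= p0 x by apply: le_trans (rp x) (pp0 x).
have /(congr1 sval) // := pmin (exist _ r (conj sr rp0)) (introT (asboolP _) rp).
Qed.

Variable nZ : Z -> R.
Hypothesis nZ_norm : is_cnorm nZ.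

Lemma cnormD x y : nZ (x + y) <= nZ x + nZ y. Proof. by case: nZ_norm. Qed.

Lemma cnormZ a x : nZ (a *: x) = cabs a * nZ x. Proof. by case: nZ_norm. Qed.

Lemma cnorm0 : nZ 0 = 0.
Proof. by rewrite -(scale0r (0 : Z)) cnormZ cabs0 mul0r. Qed.

Lemma cnormN x : nZ (- x) = nZ x.
Proof. by rewrite -scaleN1r cnormZ cabsN cabs1 mul1r. Qed.

Lemma cnorm_ge0 x : 0 <= nZ x.
Proof. by have := cnormD x (- x); rewrite subrr cnorm0 cnormN; lra. Qed.

(* The subspace and the functional on it are given by a parametrisation
   [(j u, f u)], [A u], of the graph. *)
Lemma hahn_banach (V : Type) (A : set V) (j : V -> Z) (f : V -> R[i]) :
  (exists u, A u) ->
  (forall a u v, A u -> A v -> exists2 w, A w & j w = a *: j u + j v /\ f w = a * f u + f v) ->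
  (forall u, A u -> cabs (f u) <= nZ (j u)) ->
  exists F : Z -> R[i],
    [/\ forall a x y, F (a *: x + y) = a * F x + F y,
        forall x, cabs (F x) <= nZ x & forall u, A u -> F (j u) = f u].
Proof.
move=> [u1 Au1] A_lin f_le.
have [u0 Au0 []] := A_lin (-1) u1 u1 Au1 Au1.
rewrite scaleN1r addNr mulN1r addNr => ju0 fu0.
have A_scale a u : A u -> exists2 w, A w & j w = a *: j u /\ f w = a * f u.
  by move=> Au; have := A_lin a u u0 Au Au0; rewrite ju0 fu0 !addr0.
pose W x := [set nZ (x - j u) + complex.Re (f u) | u in A].
have Re_f u : A u -> - nZ (j u) <= complex.Re (f u).
  move=> Au; have := f_le u Au; have := Re_le_cabs (- f u); rewrite cabsN.
  have -> : complex.Re (- f u) = - complex.Re (f u) by case: (f u).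
  by lra.
have lbW x : has_lbound (W x).
  exists (- nZ x) => _ [u Au <-]; have := Re_f u Au.
  by have := cnormD (j u - x) x; rewrite subrK -(cnormN (j u - x)) opprB; lra.
(* A minimal functional below [p0] is bounded by the norm (take [u0]) and by the real part of [f] on
   the subspace; applied to [u] and to its negative, the latter becomes an equality. *)
pose p0 x := inf (W x).
have p0_le x u : A u -> p0 x <= nZ (x - j u) + complex.Re (f u).
  by move=> Au; apply: ge_inf => //; exists u.
have p0_ge x K : (forall u, A u -> K <= nZ (x - j u) + complex.Re (f u)) -> K <= p0 x.
  move=> h; apply: lb_le_inf; last by move=> _ [u Au <-]; apply: h.
  by exists (nZ (x - j u1) + complex.Re (f u1)); exists u1.
have ReD (a b : R[i]) : complex.Re (a + b) = complex.Re a + complex.Re b.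
  by case: a; case: b.
have ImD (a b : R[i]) : complex.Im (a + b) = complex.Im a + complex.Im b.
  by case: a; case: b.
have ReM (a b : R[i]) :
    complex.Re (a * b) = complex.Re a * complex.Re b - complex.Im a * complex.Im b.
  by case: a; case: b.
have ImM (a b : R[i]) :
    complex.Im (a * b) = complex.Re a * complex.Im b + complex.Im a * complex.Re b.
  by case: a; case: b.
have ReZ r (a : R[i]) : complex.Re (rC r * a) = r * complex.Re a.
  by case: a => a b; rewrite /= mul0r subr0.
have sp0 : sublinear p0.
  split=> [x y|r x].
    rewrite -lerBlDr; apply: (p0_ge) => u Au; rewrite lerBlDr -lerBlDl.
    apply: (p0_ge) => v Av; rewrite lerBlDl.
    have [w Aw []] := A_lin 1 u v Au Av; rewrite scale1r mul1r => jw fw.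
    apply: le_trans (p0_le _ w Aw) _; rewrite jw fw ReD opprD addrACA.
    by have := cnormD (x - j u) (y - j v); lra.
  rewrite le_eqVlt => /orP[/eqP <-|r0].
    rewrite rmorph0 scale0r mul0r; apply: le_trans (p0_le 0 u0 Au0) _.
    by rewrite ju0 fu0 subrr cnorm0 addr0.
  rewrite -ler_pdivrMl //; apply: (p0_ge) => u Au; rewrite ler_pdivrMl //.
  have [w Aw [jw fw]] := A_scale (rC r) u Au.
  apply: le_trans (p0_le _ w Aw) _; rewrite jw fw ReZ -scalerBr cnormZ.
  by rewrite cabs_rC_ge0 ?(ltW r0) // mulrDr.
have [p mp pp0] := exists_minimal sp0.
have p_le x : p x <= nZ x.
  apply: le_trans (pp0 x) _; apply: le_trans (p0_le x u0 Au0) _.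
  by rewrite ju0 fu0 subr0 addr0.
have p_j u : A u -> p (j u) = complex.Re (f u).
  have h v : A v -> p (j v) <= complex.Re (f v).
    move=> Av; apply: le_trans (pp0 _) _; apply: le_trans (p0_le _ v Av) _.
    by rewrite subrr cnorm0 add0r.
  move=> Au; apply/eqP; rewrite eq_le h //=.
  have [w Aw []] := A_scale (-1) u Au; rewrite scaleN1r mulN1r => jw fw.
  have := h w Aw; rewrite jw fw minimalN //.
  have -> : complex.Re (- f u) = - complex.Re (f u) by case: (f u).
  by rewrite lerN2.
pose im : R[i] := Complex 0 1.
have imim : im * im = -1.
  by apply/eqP; rewrite eq_complex /=; apply/andP; split; apply/eqP; ring.
(* The complex-linear functional with real part [p]. Multiplying [x] by a unimodular [th] that makes
   [F (th *: x)] real and nonnegative transfers the bound from [p] to [F]. *)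
pose F x : R[i] := Complex (p x) (- p (im *: x)).
have cE (a : R[i]) : a = rC (complex.Re a) + rC (complex.Im a) * im.
  case: a => a b; apply/eqP; rewrite eq_complex /=.
  by apply/andP; split; apply/eqP; ring.
have pS (a : R[i]) x : p (a *: x) = complex.Re a * p x + complex.Im a * p (im *: x).
  rewrite {1}(cE a) scalerDl (minimal_additive _ _ mp) -scalerA.
  by rewrite !minimalZ.
have F_lin a x y : F (a *: x + y) = a * F x + F y.
  apply/eqP; rewrite eq_complex; apply/andP; split; apply/eqP.
    by rewrite ReD ReM /F /= (minimal_additive _ _ mp) (pS a); ring.
  rewrite ImD ImM /F /= scalerDr (minimal_additive _ _ mp) scalerA (pS (im * a)).
  by rewrite ReM ImM /=; ring.
have F0 : F 0 = 0.
  by rewrite /F scaler0 (sublin0 mp.1) oppr0.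
have FZ a x : F (a *: x) = a * F x by have := F_lin a x 0; rewrite !addr0 F0 addr0.
exists F; split=> // [x|u Au].
  have [Fx0|Fx0] := eqVneq (F x) 0; first by rewrite Fx0 cabs0 cnorm_ge0.
  have nF0 : cabs (F x) != 0 by rewrite cabs_eq0.
  pose th := conjc (F x) / rC (cabs (F x)).
  have th1 : cabs th = 1.
    by rewrite /th cabsM cabsV cabs_conj cabs_rC_ge0 ?cabs_ge0 // divff.
  have e : F (th *: x) = rC (cabs (F x)).
    rewrite FZ /th mulrAC [conjc _ * _]mulrC mul_conjc expr2 rmorphM /= mulfK //.
    by rewrite fmorph_eq0.
  have := p_le (th *: x); rewrite cnormZ th1 mul1r.
  by have := congr1 (@complex.Re R) e; rewrite /F /= => ->.
have [w Aw [jw fw]] := A_scale im u Au.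
rewrite /F p_j // -jw p_j // fw; case: (f u) => a b.
by apply/eqP; rewrite eq_complex /=; apply/andP; split; apply/eqP; ring.
Qed.

End HahnBanach.

(** * Projections of norm [O(sqrt #|S|)] from an arbitrary superspace *)

Section ProjectionUpper.
Variables (R : realType) (n m : nat) (q : ('I_n -> R[i]) -> R).
Hypothesis q_norm : lattice_norm q.
Variable S : {set MI n m}.
Hypothesis S_neq0 : S != finset.set0.

Definition supported (c : MI n m -> R[i]) := forall a, a \notin S -> c a = 0.

Lemma monom_bounded :
  exists2 D, 0 <= D & forall z (a : MI n m), q z < 1 -> cabs (monom a z) <= D.
Proof.
have [D D1 zD] := ball_bounded q_norm.
have D0 : 0 <= D := le_trans ler01 D1.
exists ((D ^+ m) ^+ n) => [|z a z1]; first by rewrite !exprn_ge0.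
rewrite cabs_monom -[n in _ ^+ n]card_ord -prodr_const; apply: ler_prod => i _.
rewrite exprn_ge0 ?cabs_ge0 //=; apply: (@le_trans _ _ (D ^+ a i)).
  by rewrite lerXn2r ?nnegrE ?cabs_ge0 ?zD.
by rewrite ler_weXn2l // -ltnS ltn_ord.
Qed.

(* A probability measure on [N] points of the ball for which the monomials in
   [S] span a space whose Christoffel function is bounded by [6 #|S|]. *)
Lemma exists_sampling : exists N (nu : 'I_N -> R) (zz : 'I_N -> 'I_n -> R[i]),
  let u a := \sum_j nu j * cabs (monom a (zz j)) ^+ 2 in
  [/\ forall j, 0 <= nu j, forall j, q (zz j) < 1, \sum_j nu j = 1,
      forall a, a \in S -> 0 < u a &
      forall z, q z < 1 -> \sum_(a in S) cabs (monom a z) ^+ 2 / u a <= 6 * #|S|%:R].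
Proof.
pose F (z : 'I_n -> R[i]) (t : 'I_#|S|) := cabs (monom (enum_val t) z) ^+ 2.
have [D D0 zD] := monom_bounded.
have [t t0 t1] := exists_positive_point q_norm.
have [|||N [nu [zz [nu0 zz1 nu1 u0 le6]]]] :=
    @lozanovskii R _ 'I_#|S| [set z | q z < 1] F (D ^+ 2).
- by rewrite card_ord card_gt0.
- move=> z a z1; rewrite sqr_ge0 /= /F.
  by rewrite lerXn2r ?nnegrE ?cabs_ge0 ?zD.
- exists (fun=> rC t); split=> // a; rewrite exprn_gt0 // cabs_monom.
  by apply: prodr_gt0 => i _; rewrite exprn_gt0 // cabs_rC_ge0 // ltW.
exists N, nu, zz; split=> // [a aS|z z1].
  by have := u0 (enum_rank_in aS a); rewrite /F enum_rankK_in.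
have := le6 z z1; rewrite card_ord; apply: le_trans.
by rewrite [X in X <= _]big_enum_val /F.
Qed.

Variables (Z : lmodType R[i]) (nZ : Z -> R) (iota : MI n m -> Z).
Hypothesis nZ_norm : is_cnorm nZ.

Let emb (c : MI n m -> R[i]) := \sum_a c a *: iota a.

Hypothesis iota_isometry : forall c, supported c -> nZ (emb c) = supnorm q c.

Lemma exists_evaluation z : q z < 1 -> exists F : Z -> R[i],
  [/\ forall a x y, F (a *: x + y) = a * F x + F y,
      forall x, cabs (F x) <= nZ x &
      forall c, supported c -> F (emb c) = peval c z].
Proof.
move=> z1.
have [|||F FP] := @hahn_banach R Z nZ nZ_norm _ supported emb (fun c => peval c z).
- by exists (fun=> 0).
- move=> a u v Su Sv; exists (fun b => a * u b + v b).
    by move=> b bS; rewrite Su // Sv // mulr0 addr0.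
  split; first by rewrite /emb scaler_sumr -big_split; apply: eq_bigr => b _;
    rewrite scalerDl scalerA.
  rewrite /peval mulr_sumr -big_split; apply: eq_bigr => b _ /=; ring.
- by move=> u Su; rewrite iota_isometry //; apply: peval_le_supnorm.
by exists F.
Qed.

(** The value of [P x] at [z] is a sum over [S]; Cauchy-Schwarz separates the Christoffel function
    at [z], at most [6 #|S|], from the Bessel sum of [Phi x], at most the squared norm of [x]
    because each [Phi w] has norm at most 1 and the weights sum to 1. *)
Lemma exists_projection : exists P : Z -> Z,
  [/\ forall a x y, P (a *: x + y) = a *: P x + P y,
      forall x, exists2 c, supported c & P x = emb c,
      forall c, supported c -> P (emb c) = emb c &
      forall x, nZ (P x) <= Num.sqrt (6 * #|S|%:R) * nZ x].
Proof.
have [N [nu [zz [nu0 zz1 nu1 u0 le6]]]] := exists_sampling.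
pose u (a : MI n m) := \sum_j nu j * cabs (monom a (zz j)) ^+ 2.
have {}u0 a : a \in S -> 0 < u a := u0 a.
(* Rotating the sample points makes the monomials orthogonal and keeps their moduli, hence also the
   norms [u a] and the bound on the Christoffel function. *)
pose G := {ffun 'I_n -> 'I_m.+1}.
pose pt (w : 'I_N * G) i := zz w.1 i * rot R w.2 i.
have pt1 w : q (pt w) < 1 by apply: ball_rot.
have [Phi PhiP] : exists Phi : 'I_N * G -> Z -> R[i], forall w,
  [/\ forall a x y, Phi w (a *: x + y) = a * Phi w x + Phi w y,
      forall x, cabs (Phi w x) <= nZ x &
      forall c, supported c -> Phi w (emb c) = peval c (pt w)].
  exists (fun w => sval (cid (exists_evaluation (pt1 w)))) => w.
  exact: (svalP (cid (exists_evaluation (pt1 w)))).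
have Phi_lin w a x y : Phi w (a *: x + y) = a * Phi w x + Phi w y.
  by have [h _ _] := PhiP w; apply: h.
have Phi_le w x : cabs (Phi w x) <= nZ x by have [_ h _] := PhiP w; apply: h.
have Phi_emb w c : supported c -> Phi w (emb c) = peval c (pt w).
  by have [_ _ h] := PhiP w; apply: h.
pose p (w : 'I_N * G) : R := nu w.1 / #|G|%:R.
pose psi (a : MI n m) w := monom a (pt w).
have G0 : (0 < #|G|)%N := card_rot_gt0 _ _.
have p0 w : 0 <= p w by rewrite divr_ge0.
have p1 : \sum_w p w = 1.
  rewrite -(pair_big xpredT xpredT (fun j g => p (j, g))) /= -nu1.
  by apply: eq_bigr => j _; rewrite -[RHS](avg_cst G0) /avg mulr_suml.
have orth a b : a \in S -> b \in S ->
    \sum_w rC (p w) * (psi a w * conjc (psi b w)) = rC (u a) *+ (a == b).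
  move=> aS bS; rewrite -(pair_big xpredT xpredT
    (fun j g => rC (p (j, g)) * (psi a (j, g) * conjc (psi b (j, g))))) /=.
  transitivity (\sum_j rC (nu j) * (monom a (zz j) * conjc (monom b (zz j))) *
     avg (fun g : G => chi R (expo a) g * conjc (chi R (expo b) g))).
    apply: eq_bigr => j _; rewrite /avg mulr_suml mulr_sumr; apply: eq_bigr => g _.
    by rewrite /psi /pt /p /= !monom_rot conjcM rmorphM fmorphV rmorph_nat; ring.
  rewrite chi_orthogonal; try exact: expo_le.
  case: eqVneq => [<-|ab].
    rewrite mulr1n rmorph_sum; apply: eq_bigr => j _ /=.
    rewrite mul_conjc -rmorphM (_ : [forall i, _]) ?mulr1 //.
    by apply/forallP => i.
  rewrite mulr0n; apply: big1 => j _.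
  case: forallP => [e|]; last by rewrite mulr0.
  by case/negP: ab; apply/eqP/expo_inj => i; apply/eqP.
pose ip x a := \sum_w rC (p w) * (Phi w x * conjc (psi a w)).
pose k x a : R[i] := if a \in S then ip x a / rC (u a) else 0.
have k_supp x : supported (k x) by move=> a /negPf aS; rewrite /k aS.
exists (fun x => emb (k x)); split.
- move=> a x y; rewrite /emb scaler_sumr -big_split; apply: eq_bigr => b _ /=.
  rewrite scalerA -scalerDl; congr (_ *: _).
  rewrite /k; case: ifP => _; last by rewrite mulr0 addr0.
  rewrite mulrA -mulrDl; congr (_ / _).
  rewrite /ip mulr_sumr -big_split; apply: eq_bigr => w _ /=.
  by rewrite Phi_lin; ring.
- by move=> x; exists (k x).
- move=> c Sc; congr (emb _); apply/funext => a; rewrite /k.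
  case: ifPn => [aS|/Sc -> //].
  have ua0 : rC (u a) != 0 by rewrite fmorph_eq0 gt_eqF ?u0.
  apply: (mulIf ua0); rewrite divfK //.
  transitivity (\sum_b c b * \sum_w rC (p w) * (psi b w * conjc (psi a w))).
    rewrite /ip; under eq_bigr => w _ do rewrite Phi_emb // /peval mulr_suml mulr_sumr.
    rewrite exchange_big; apply: eq_bigr => b _ /=.
    by rewrite mulr_sumr; apply: eq_bigr => w _; rewrite /psi; ring.
  rewrite (bigD1 a) //= orth // eqxx mulr1n -[RHS]addr0; congr (_ + _).
  apply: big1 => b ba; have [bS|/Sc ->] := boolP (b \in S); last by rewrite mul0r.
  by rewrite orth // (negPf ba) mulr0n mulr0.
move=> x; rewrite iota_isometry //; apply: supnorm_le => // z z1.
apply: (@le_trans _ _ (\sum_(a in S) (cabs (k x a) * Num.sqrt (u a)) *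
    (cabs (monom a z) / Num.sqrt (u a)))).
  apply: le_trans (cabs_sum _ _ _) _.
  rewrite (bigID (fun a => a \in S)) /= [X in _ + X]big1 ?addr0; last first.
    by move=> a /k_supp ->; rewrite mul0r cabs0.
  apply: ler_sum => a aS; rewrite cabsM mulrACA divff ?mulr1 //.
  by rewrite gt_eqF // sqrtr_gt0 u0.
apply: le_trans (cauchy_schwarz_sqrt _ _ _) _; rewrite mulrC.
apply: ler_pM; rewrite ?sqrtr_ge0 //.
  rewrite ler_wsqrtr //; apply: le_trans (le6 z z1).
  apply: ler_sum => a aS; rewrite expr_div_n sqr_sqrtr //.
  by rewrite ltW // u0.
rewrite -[X in _ <= X](ger0_norm (cnorm_ge0 nZ_norm x)) -sqrtr_sqr ler_wsqrtr //.
have := @bessel R _ _ S p (Phi^~ x) psi u p0 u0 orth.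
have -> : \sum_(a in S) cabs (\sum_w rC (p w) * (Phi w x * conjc (psi a w))) ^+ 2 / u a
   = \sum_(i in S) (cabs (k x i) * Num.sqrt (u i)) ^+ 2.
  apply: eq_bigr => a aS; rewrite -/(ip x a) /k aS exprMn sqr_sqrtr ?(ltW (u0 a aS)) //.
  rewrite cabsM cabsV cabs_rC_ge0 ?(ltW (u0 a aS)) // exprMn exprVn.
  by field; rewrite gt_eqF ?u0.
move=> /le_trans; apply; rewrite -[X in _ <= X]mul1r -p1 mulr_suml.
apply: ler_sum => w _; rewrite ler_wpM2l //.
by rewrite lerXn2r ?nnegrE ?cabs_ge0 ?cnorm_ge0.
Qed.

End ProjectionUpper.

(** * The sup-normed space of bounded functions, the superspace for the lower bound *)

Section BoundedFunctions.
Variables (R : realType) (T : Type).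

Definition bounded_function : {pred T -> R[i]} :=
  fun f => `[< exists K, forall t, cabs (f t) <= K >].

Lemma bounded_functionP f :
  reflect (exists K, forall t, cabs (f t) <= K) (f \in bounded_function).
Proof. exact: asboolP. Qed.

Lemma bounded_function_submod : GRing.submod_closed bounded_function.
Proof.
split; first by apply/bounded_functionP; exists 0 => t; rewrite cabs0.
move=> a f g /bounded_functionP[K fK] /bounded_functionP[L gL].
apply/bounded_functionP; exists (cabs a * K + L) => t.
by apply: le_trans (cabsD _ _) (lerD _ (gL t)); rewrite cabsM ler_wpM2l ?cabs_ge0.
Qed.

HB.instance Definition _ :=
  GRing.isSubmodClosed.Build R[i] (T -> R[i]) bounded_function bounded_function_submod.

Record bfun := BFun { bval : T -> R[i]; _ : bval \in bounded_function }.

HB.instance Definition _ := [isSub for bval].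
HB.instance Definition _ := [Choice of bfun by <:].
HB.instance Definition _ := [SubChoice_isSubLmodule of bfun by <:].

End BoundedFunctions.

Section SupNorm.
Variables (R : realType) (T : Type) (t0 : T).
Implicit Types f g : bfun R T.

Definition bnorm f : R := sup [set cabs (bval f t) | t in setT].

Lemma bnorm_ub f t : cabs (bval f t) <= bnorm f.
Proof.
have /bounded_functionP[K fK] := valP f.
by apply: ub_le_sup; [exists K => _ [s _ <-]; apply: fK | exists t].
Qed.

Lemma bnorm_le f K : (forall t, cabs (bval f t) <= K) -> bnorm f <= K.
Proof.
move=> fK; apply: ge_sup; last by move=> _ [t _ <-].
by exists (cabs (bval f t0)); exists t0.
Qed.

Lemma bvalD f g t : bval (f + g) t = bval f t + bval g t. Proof. by []. Qed.
Lemma bvalZ a f t : bval (a *: f) t = a * bval f t. Proof. by []. Qed.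
Lemma bvalB f g t : bval (f - g) t = bval f t - bval g t. Proof. by []. Qed.

Lemma bval_sum I (r : seq I) (P : pred I) (F : I -> bfun R T) t :
  bval (\sum_(i <- r | P i) F i) t = \sum_(i <- r | P i) bval (F i) t.
Proof. exact: (big_morph (fun f => bval f t)). Qed.

Lemma bnorm_cnorm : is_cnorm bnorm.
Proof.
split.
- move=> f g; apply: bnorm_le => t; rewrite bvalD.
  by apply: le_trans (cabsD _ _) _; rewrite lerD ?bnorm_ub.
- move=> a f; apply/eqP; rewrite eq_le; apply/andP; split.
    by apply: bnorm_le => t; rewrite bvalZ cabsM ler_wpM2l ?cabs_ge0 ?bnorm_ub.
  have [->|a0] := eqVneq a 0.
    rewrite cabs0 mul0r scale0r; apply: le_trans (bnorm_ub _ t0).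
    exact: cabs_ge0.
  rewrite mulrC -ler_pdivlMr ?cabs_gt0 //; apply: bnorm_le => t.
  by rewrite ler_pdivlMr ?cabs_gt0 // mulrC -cabsM -bvalZ bnorm_ub.
- move=> f f0; apply/val_inj/funext => t; apply/eqP; rewrite -cabs_eq0 eq_le cabs_ge0 andbT.
  by rewrite -f0 bnorm_ub.
Qed.

(** An unbounded [f] is sent to 0; [bval_mkbfun] is the guard for each use. *)
Definition mkbfun (f : T -> R[i]) : bfun R T := insubd 0 f.

Lemma bval_mkbfun (f : T -> R[i]) : (exists K, forall t, cabs (f t) <= K) -> bval (mkbfun f) = f.
Proof. by move=> /bounded_functionP fb; apply: insubdK. Qed.

End SupNorm.

(** * Lower bound for the norm of a projection from the bounded functions on the ball *)

Section ProjectionLower.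
Variables (R : realType) (n m : nat) (q : ('I_n -> R[i]) -> R).
Hypothesis q_norm : lattice_norm q.
Variable S : {set MI n m}.

Lemma projection_bound_ge1 (Z : lmodType R[i]) (nZ : Z -> R) (iota : MI n m -> Z)
    (P : Z -> Z) (K : R) : S != finset.set0 ->
  (forall c, supported S c -> nZ (\sum_a c a *: iota a) = supnorm q c) ->
  (forall c, supported S c -> P (\sum_a c a *: iota a) = \sum_a c a *: iota a) ->
  (forall x, nZ (P x) <= K * nZ x) -> 1 <= K.
Proof.
move=> /set0Pn[b bS] isom fixP PK.
pose c (a : MI n m) : R[i] := (a == b)%:R.
have Sc : supported S c by move=> a aS; rewrite /c; case: eqP aS => // ->; rewrite bS.
have cb : c b != 0 by rewrite /c eqxx oner_eq0.
have := PK (\sum_a c a *: iota a); rewrite fixP // isom //.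
by rewrite -[X in X <= _]mul1r ler_pM2r // (supnorm_gt0 q_norm cb).
Qed.

Definition ball_point := {z : 'I_n -> R[i] | q z < 1}.

Definition origin : ball_point.
Proof. by exists (fun=> 0); rewrite norm0 // ltr01. Defined.

Definition monom_fun (a : MI n m) : bfun R ball_point :=
  mkbfun (fun z : ball_point => monom a (sval z)).

Lemma bval_monom_fun a z : bval (monom_fun a) z = monom a (sval z).
Proof.
rewrite bval_mkbfun //; have [D _ zD] := monom_bounded m q_norm.
by exists D => y; apply/zD/(svalP y).
Qed.

Lemma bval_sum_monom_fun c z : bval (\sum_a c a *: monom_fun a) z = peval c (sval z).
Proof.
by rewrite bval_sum; apply: eq_bigr => a _; rewrite bvalZ bval_monom_fun.
Qed.

Lemma bnorm_sum_monom_fun c : bnorm (\sum_a c a *: monom_fun a) = supnorm q c.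
Proof.
apply/eqP; rewrite eq_le; apply/andP; split.
  apply: (bnorm_le origin) => z; rewrite bval_sum_monom_fun.
  by apply: peval_le_supnorm => //; apply: (svalP z).
apply: supnorm_le => // z z1.
have := bnorm_ub (\sum_a c a *: monom_fun a) (exist _ z z1 : ball_point).
by rewrite bval_sum_monom_fun.
Qed.

Let Z := bfun R ball_point.

Variables (P : Z -> Z) (K : R).
Hypothesis P_lin : forall a x y, P (a *: x + y) = a *: P x + P y.
Hypothesis P_range : forall x, exists2 c, supported S c & P x = \sum_a c a *: monom_fun a.
Hypothesis P_fix : forall c, supported S c ->
  P (\sum_a c a *: monom_fun a) = \sum_a c a *: monom_fun a.
Hypothesis P_norm : forall x, bnorm (P x) <= K * bnorm x.
Hypothesis S_deg : forall a, a \in S -> (mdeg a <= m)%N.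
Variable v : 'I_n -> R[i].
Hypotheses (v1 : q v < 1) (v0 : forall i, v i != 0).

Let N := (m + m)%N.
Let G := {ffun 'I_n -> 'I_N.+1}.

Let G0 : (0 < #|G|)%N. Proof. exact: card_rot_gt0. Qed.

Let vpt (w : G) : ball_point :=
  exist (fun z => q z < 1) (fun i => v i * rot R w i) (ball_rot q_norm w v1).

(* The coefficient of [P x] at [b], times the value at [v] of the monomial. *)
Let coef b (x : Z) := avg (fun w => bval (P x) (vpt w) * conjc (chi R (expo (b : MI n m)) w)).

Let coefE b x c : P x = \sum_a c a *: monom_fun a -> coef b x = c b * monom b v.
Proof.
move=> Px; rewrite -(@avg_peval R n m N c v b) ?leq_addr //; apply: eq_avg => w.
by rewrite Px bval_sum_monom_fun.
Qed.

Let PD x y : P (x + y) = P x + P y.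
Proof. by have := P_lin 1 x y; rewrite !scale1r. Qed.

Let P0 : P 0 = 0.
Proof. by apply: (addrI (P 0)); rewrite -PD !addr0. Qed.

Let PZ a x : P (a *: x) = a *: P x.
Proof. by have := P_lin a x 0; rewrite P0 !addr0. Qed.

Let coefD b x y : coef b (x + y) = coef b x + coef b y.
Proof. by rewrite /coef -avgD; apply: eq_avg => w; rewrite PD bvalD mulrDl. Qed.

Let coefZ b a x : coef b (a *: x) = a * coef b x.
Proof. by rewrite /coef -avgZ; apply: eq_avg => w; rewrite PZ bvalZ mulrA. Qed.

Let coef_sum b I (r : seq I) (Q : pred I) (F : I -> Z) :
  coef b (\sum_(i <- r | Q i) F i) = \sum_(i <- r | Q i) coef b (F i).
Proof.
apply: (big_morph (coef b) (coefD b)).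
by have := coefZ b 0 0; rewrite scale0r mul0r.
Qed.

Let cabs_coef b x : cabs (coef b x) <= K * bnorm x.
Proof.
apply: le_trans (cabs_avg _) _; rewrite -[X in _ <= X](avg_cst G0).
apply: ler_avg => w; rewrite cabsM cabs_conj cabs_chi mulr1.
exact: le_trans (bnorm_ub _ _) (P_norm _).
Qed.

(** The unit ball of the bounded functions with values in [l2(S)]. On it [Psi] acts like a trace:
    the image of each component is tested on its own monomial only. *)
Let admissible (t : MI n m -> Z) :=
  forall z, \sum_(b in S) cabs (bval (t b) z) ^+ 2 <= 1.

Let Psi (t : MI n m -> Z) := \sum_(b in S) coef b (t b).

Let lam : R := 2 * 2 ^+ m.

Hypothesis K0 : 0 <= K.

(* The function of the rotation with coefficients [t] is truncated at height
   [lam]: the coefficients [r] of the remainder have half the l2 norm, and the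
   truncated part is controlled by evaluating [P] at the rotations of [v]. *)
Let Psi_split t : admissible t -> exists2 r : MI n m -> Z,
  (forall z, \sum_(b in S) cabs (bval (r b) z) ^+ 2 <= 4^-1) &
  cabs (Psi t) <= lam * K + cabs (Psi r).
Proof.
move=> adm.
have lam0 : 0 < lam by rewrite mulr_gt0 // exprn_gt0.
(* The conjugation is arranged so that [t b] is the average of [conjc f] times the character of [b];
   the same characters then recombine the coefficients of [P (Gw w)] into a polynomial value. *)
pose c z (b : MI n m) : R[i] := if b \in S then conjc (bval (t b) z) else 0.
pose f z (w : G) := \sum_b c z b * chi R (expo b) w.
pose g z w := if cabs (f z w) <= lam then conjc (f z w) else 0.
have g_le z w : cabs (g z w) <= lam.
  by rewrite /g; case: ifP => [|_]; rewrite ?cabs_conj // cabs0 ltW.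
pose Gw w : Z := mkbfun (g^~ w).
have GwE w z : bval (Gw w) z = g z w.
  by rewrite bval_mkbfun //; exists lam => y; apply: g_le.
pose hat (b : MI n m) : Z := \sum_w (chi R (expo b) w / #|G|%:R) *: Gw w.
pose r b := t b - hat b.
have rE z b : b \in S -> bval (r b) z =
    avg (fun w => conjc (f z w) * chi R (expo b) w - g z w * chi R (expo b) w).
  move=> bS; rewrite bvalB /avg sumrB mulrBl; congr (_ - _).
    have := @avg_peval R n m N (c z) (fun=> 1) b (leq_addr _ _).
    rewrite /c bS /monom [X in _ * X]big1 ?mulr1; last by move=> i _; rewrite expr1n.
    move=> /(congr1 conjc); rewrite conjcK => <-; rewrite /avg conjcM conjc_inv conjc_nat.
    congr (_ / _); rewrite conjc_sum; apply: eq_bigr => w _.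
    rewrite conjcM conjcK; congr (conjc _ * _).
    rewrite peval_rot; apply: eq_bigr => a _.
    by rewrite /monom [X in _ * X * _]big1 ?mulr1 // => i _; rewrite expr1n.
  rewrite bval_sum mulr_suml; apply: eq_bigr => w _.
  by rewrite bvalZ GwE; ring.
have cdeg z b : c z b != 0 -> (mdeg b <= m)%N.
  by rewrite /c; case: ifP => [/S_deg //|_]; rewrite eqxx.
have csum z : \sum_b cabs (c z b) ^+ 2 <= 1.
  apply: le_trans (adm z); rewrite [X in _ <= X]big_mkcond; apply: ler_sum => b _.
  by rewrite /c; case: ifP; rewrite ?cabs_conj // cabs0 expr0n.
exists r => [z|].
  pose e w := conjc (f z w) - g z w.
  have := @bessel R _ _ S (fun _ : G => #|G|%:R^-1) e
    (fun b w => conjc (chi R (expo b) w)) (fun=> 1).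
  have orth a b : a \in S -> b \in S -> \sum_(w : G) rC #|G|%:R^-1 *
      (conjc (chi R (expo a) w) * conjc (conjc (chi R (expo b) w))) = rC 1 *+ (a == b).
    move=> aS bS; rewrite -mulr_sumr rmorph1 fmorphV rmorph_nat mulrC.
    have := @chi_orthogonal R 'I_n N (expo b) (expo a).
    have eN (x : MI n m) i : (expo x i <= N)%N.
      by apply: leq_trans (expo_le x i) (leq_addr _ _).
    move=> /(_ (eN b) (eN a)); rewrite /avg.
    under [X in X / _ = _ -> _]eq_bigr => w _ do rewrite mulrC -[chi R (expo b) w]conjcK.
    move=> ->; rewrite -mulr_natr mul1r; congr (_%:R); congr nat_of_bool.
    apply/forallP/eqP => [ab|-> //]; apply/esym/expo_inj => i; exact/eqP.
  move=> /(_ (fun _ => _) (fun _ _ => ltr01) orth).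
  have -> : \sum_(b in S) cabs (\sum_w rC #|G|%:R^-1 *
      (e w * conjc (conjc (chi R (expo b) w)))) ^+ 2 / 1
      = \sum_(b in S) cabs (bval (r b) z) ^+ 2.
    apply: eq_bigr => b bS; rewrite divr1 rE // /avg -mulr_sumr fmorphV rmorph_nat mulrC.
    congr (cabs (_ / _) ^+ 2); apply: eq_bigr => w _.
    by rewrite conjcK /e mulrBl.
  move=> h; apply: le_trans (h _) _; first by rewrite invr_ge0.
  (* The remainder lives where [|f| > lam], and there [|f|^2 <= lam^-2 |f|^4]; the choice
     [lam = 2 * 2 ^+ m] turns [lam^-2 4^m] into [1/4]. *)
  apply: (@le_trans _ _ (avg (fun w => lam ^- 2 * cabs (f z w) ^+ 4))).
    rewrite /avg mulr_suml; apply: ler_sum => w _; rewrite mulrC ler_wpM2r ?invr_ge0 //.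
    rewrite /e /g; case: ifPn => [_|]; first by rewrite subrr cabs0 expr0n mulr_ge0 ?invr_ge0 ?exprn_ge0 ?cabs_ge0 // ltW.
    rewrite -ltNge subr0 cabs_conj => ltf; rewrite mulrC ler_pdivlMr ?exprn_gt0 //.
    rewrite (_ : 4 = 2 + 2)%N // exprD ler_wpM2l ?sqr_ge0 //.
    by rewrite lerXn2r ?nnegrE ?cabs_ge0 // ltW.
  rewrite avgZ mulrC ler_pdivrMr ?exprn_gt0 //.
  apply: le_trans (avg_L4_le (leqnn _) (@cdeg z)) _.
  have -> : 4^-1 * lam ^+ 2 = 4 ^+ m * 1.
    by rewrite /lam exprMn -exprM mulnC exprM (_ : 2 ^+ 2 = 4 :> R); [field | ring].
  rewrite ler_wpM2l ?exprn_ge0 //; apply: exprn_ile1 (csum z).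
  by apply: sumr_ge0 => b _; apply: sqr_ge0.
have -> : Psi t = Psi hat + Psi r.
  by rewrite /Psi -big_split; apply: eq_bigr => b _ /=; rewrite -coefD /r addrC subrK.
apply: le_trans (cabsD _ _) _; rewrite lerD2r.
(* Since [P (Gw w)] lies in the span of the monomials in [S], its coefficients times the characters
   at [w], summed over [S], give its value at the rotated point. *)
have -> : Psi hat = avg (fun w => bval (P (Gw w)) (vpt w)).
  rewrite /Psi /avg mulr_suml.
  under eq_bigr => b _ do rewrite coef_sum.
  rewrite exchange_big; apply: eq_bigr => w _ /=.
  have [d Sd Pd] := P_range (Gw w).
  rewrite Pd bval_sum_monom_fun peval_rot mulr_suml [RHS](bigID (fun a => a \in S)) /=.
  rewrite [X in _ = _ + X]big1 ?addr0; last by move=> b /Sd ->; rewrite !mul0r.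
  apply: eq_bigr => b _; rewrite coefZ (coefE b Pd); ring.
apply: le_trans (cabs_avg _) _; rewrite -[X in _ <= X](avg_cst G0).
apply: ler_avg => w; apply: le_trans (bnorm_ub _ _) _.
rewrite mulrC; apply: le_trans (P_norm _) _; rewrite ler_wpM2l //.
by apply: (bnorm_le origin) => z; rewrite GwE.
Qed.

(** Twice the remainder is again admissible, so the supremum [s] of [|Psi|] obeys
    [s <= lam * K + s / 2]. The crude bound by [#|S|] times [K] only ensures that [s] is finite. *)
Let Psi_le t : admissible t -> cabs (Psi t) <= 4 * 2 ^+ m * K.
Proof.
move=> adm_t; pose E := [set cabs (Psi t) | t in admissible].
have ubE : has_ubound E.
  exists (\sum_(b in S) K) => _ [s adm <-]; apply: le_trans (cabs_sum _ _ _) _.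
  apply: ler_sum => b bS; apply: le_trans (cabs_coef _ _) _.
  rewrite -[X in _ <= X]mulr1 ler_wpM2l //; apply: (bnorm_le origin) => z.
  rewrite -(@expr_le1 _ 2) ?cabs_ge0 //; apply: le_trans (adm z).
  by rewrite (bigD1 b) //= lerDl sumr_ge0 // => a _; apply: sqr_ge0.
have le_sup s : admissible s -> cabs (Psi s) <= sup E.
  by move=> adm; apply: ub_le_sup => //; exists s.
have supE : sup E <= lam * K + sup E / 2.
  apply: ge_sup; first by exists (cabs (Psi t)); exists t.
  move=> _ [s adm <-]; have [r r4 le_s] := Psi_split adm.
  apply: le_trans le_s _; rewrite lerD2l.
  have : cabs (Psi (fun b => 2 *: r b)) <= sup E.
    apply: le_sup => z; under eq_bigr => b _ do rewrite bvalZ cabsM cabs_nat exprMn.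
    by rewrite -mulr_sumr; have := r4 z; lra.
  have -> : Psi (fun b => 2 *: r b) = 2 * Psi r.
    by rewrite /Psi mulr_sumr; apply: eq_bigr => b _; rewrite coefZ.
  by rewrite cabsM cabs_nat; lra.
by have := le_sup t adm_t; move: supE; rewrite /lam; lra.
Qed.

Lemma card_le_projection_bound (S' : {set MI n m}) (L : R) : 0 < L -> S' \subset S ->
  (forall z, q z < 1 ->
     \sum_(a in S') (cabs (monom a z) / cabs (monom a v)) ^+ 2 <= L ^+ 2) ->
  #|S'|%:R <= 4 * 2 ^+ m * L * K.
Proof.
move=> L0 sub le_L.
have mv0 (b : MI n m) : monom b v != 0.
  by rewrite /monom prodf_seq_neq0; apply/allP => i _; rewrite expf_neq0.
(* The test family is [(z / v)^b / L]. [P] fixes its members and [coef b] restores the factor [v^b],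
   so each [b] in [S'] contributes exactly [1 / L] to [Psi]. *)
pose s (b : MI n m) : R[i] := if b \in S' then (rC L * monom b v)^-1 else 0.
pose t b : Z := s b *: monom_fun b.
have rL0 : rC L != 0 by rewrite fmorph_eq0 gt_eqF.
have tE b z : bval (t b) z = s b * monom b (sval z) by rewrite bvalZ bval_monom_fun.
have adm : admissible t.
  move=> z; under eq_bigr => b _ do rewrite tE.
  apply: (@le_trans _ _ (L ^- 2 * \sum_(a in S')
      (cabs (monom a (sval z)) / cabs (monom a v)) ^+ 2)); last first.
    rewrite mulrC ler_pdivrMr ?exprn_gt0 // mul1r; exact: le_L (svalP z).
  rewrite mulr_sumr [X in X <= _](bigID (fun b => b \in S')) /=.
  rewrite [X in _ + X]big1 ?addr0; last first.
    by move=> b /andP[_ /negPf bS']; rewrite /s bS' mul0r cabs0 expr0n.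
  rewrite (eq_bigl (fun b => b \in S')); last first.
    by move=> b; rewrite andb_idl // => /(fintype.subsetP sub).
  apply: ler_sum => b bS'; rewrite /s bS'.
  rewrite !cabsM cabsV cabsM cabs_rC_ge0 ?(ltW L0) // le_eqVlt; apply/orP; left.
  by apply/eqP; field; rewrite ?gt_eqF ?cabs_gt0 ?mv0.
have := Psi_le adm.
have -> : Psi t = rC (#|S'|%:R / L).
  rewrite /Psi (bigID (fun b => b \in S')) /= [X in _ + X]big1 ?addr0; last first.
    move=> b /andP[_ /negPf bS']; rewrite /t /s bS' coefZ mul0r //.
  rewrite (eq_bigl (fun b => b \in S')); last first.
    by move=> b; rewrite andb_idl // => /(fintype.subsetP sub).
  rewrite (eq_bigr (fun=> (rC L)^-1)) => [|b bS'].
    by rewrite sumr_const rmorphM fmorphV rmorph_nat /= -[LHS]mulr_natl.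
  pose d (a : MI n m) : R[i] := (a == b)%:R.
  have Sd : supported S d.
    move=> a aS; rewrite /d; case: eqP aS => // ->.
    by rewrite (fintype.subsetP sub).
  have dE : \sum_a d a *: monom_fun a = monom_fun b.
    rewrite (bigD1 b) //= /d eqxx scale1r big1 ?addr0 // => a /negPf ->.
    by rewrite scale0r.
  have := P_fix Sd; rewrite {1}dE => Pb.
  rewrite /t coefZ (coefE b Pb) /d eqxx mul1r /s bS' invfM -mulrA mulVf ?mulr1 //.
rewrite cabs_rC_ge0; last by rewrite divr_ge0 // ltW.
by rewrite ler_pdivrMr // mulrAC.
Qed.

End ProjectionLower.

(** * The number and the weighted sums of tetrahedral monomials *)

Section TetrahedralMonomials.
Variables (R : realType) (n m : nat).

Definition tetrahedral : {set MI n m} :=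
  [set a : MI n m | [forall i, (a i <= 1)%N] && (mdeg a == m)]%SET.

Lemma tetrahedralP (a : MI n m) :
  reflect ((forall i, (a i <= 1)%N) /\ mdeg a = m) (a \in tetrahedral).
Proof.
rewrite inE; apply: (iffP andP) => [[/forallP h /eqP e]|[h e]]; split=> //.
  exact/forallP.
exact/eqP.
Qed.

(** Indicators of [m]-subsets are tetrahedral, and ['C(n, m)] is the product of the
    [(n - i) / (m - i)], [i < m], each at least [n / m]. *)
Lemma card_tetrahedral_ge : (m <= n)%N -> (0 < m)%N ->
  (n%:R / m%:R) ^+ m <= (#|tetrahedral|%:R : R).
Proof.
move=> mn m0.
pose ind (A : {set 'I_n}) : MI n m := [ffun i => inord (i \in A)].
have indE A i : ind A i = (i \in A) :> nat.
  by rewrite ffunE inordK //; case: (i \in A); rewrite ?ltnS.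
have ind_inj : injective ind.
  move=> A B AB; apply/finset.setP => i.
  have := congr1 (fun a : MI n m => nat_of_ord (a i)) AB; rewrite /= !indE.
  by case: (i \in A); case: (i \in B).
have le_card : ('C(n, m) <= #|tetrahedral|)%N.
  rewrite -[in 'C(n, m)](card_ord n) -card_draws -(card_imset _ ind_inj).
  apply: subset_leq_card; apply/fintype.subsetP => _ /imsetP[A + ->].
  rewrite inE => /eqP Am; apply/tetrahedralP; split=> [i|].
    by rewrite indE; case: (i \in A).
  rewrite /mdeg -[RHS]Am -sum1_card [RHS]big_mkcond; apply: eq_bigr => i _.
  by rewrite indE; case: (i \in A).
apply: le_trans (_ : 'C(n, m)%:R <= _); last by rewrite ler_nat.
have m0' : 0 < (m%:R : R) by rewrite ltr0n.
rewrite expr_div_n ler_pdivrMr ?exprn_gt0 // -!natrX -natrM ler_nat.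
rewrite -(leq_pmul2r (fact_gt0 m)) mulnAC bin_ffact -ffactnn !ffact_prod.
have powE k : (k ^ m = \prod_(i < m) k)%N by rewrite prod_nat_const card_ord.
rewrite !powE -!big_split /=.
apply: leq_prod => i _; rewrite mulnBr mulnBl (mulnC n m).
by apply: leq_sub2l; rewrite (mulnC n) leq_mul2l mn orbT.
Qed.

(** The left side is the elementary symmetric polynomial of degree [m]. With [t] scaled by
    [l = m / n] it is at most [prod (1 + l t_i) <= exp (l sum t_i)]. *)
Lemma sum_tetrahedral_le (t : 'I_n -> R) (C : R) : (0 < n)%N -> (0 < m)%N ->
  (forall i, 0 <= t i) -> \sum_i t i <= C * n%:R ->
  \sum_(a in tetrahedral) \prod_i t i ^+ a i <= (n%:R / m%:R) ^+ m * expR (C * m%:R).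
Proof.
move=> n0 m0 t0 sum_t.
have n0' : 0 < (n%:R : R) by rewrite ltr0n.
have m0' : 0 < (m%:R : R) by rewrite ltr0n.
pose l : R := m%:R / n%:R; have l0 : 0 < l by rewrite divr_gt0.
have lt0 i : 0 <= l * t i by rewrite mulr_ge0 // ltW.
have -> : n%:R / m%:R = l^-1 by rewrite /l invf_div.
rewrite exprVn mulrC ler_pdivlMr ?exprn_gt0 // mulr_suml.
pose F (i : 'I_n) (j : 'I_m.+1) := if (j <= 1)%N then (l * t i) ^+ j else 0.
have F0 i j : 0 <= F i j by rewrite /F; case: ifP; rewrite ?exprn_ge0.
apply: (@le_trans _ _ (\sum_(a : MI n m) \prod_i F i (a i))).
  rewrite big_mkcond; apply: ler_sum => a _.
  case: ifPn => [/tetrahedralP[a1 am]|_]; last by apply: prodr_ge0.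
  rewrite -[in l ^+ m]am /mdeg -prodrXr -big_split /= le_eqVlt; apply/orP; left.
  by apply/eqP; apply: eq_bigr => i _; rewrite /F a1 -exprMn mulrC.
rewrite -(bigA_distr_bigA F).
apply: (@le_trans _ _ (\prod_(i < n) expR (l * t i))).
  apply: ler_prod => i _; rewrite sumr_ge0 //=.
  apply: le_trans (expR_ge1Dx _).
  by rewrite /F; case: (m) m0 => // k _; rewrite !big_ord_recl /= expr0 expr1 big1 ?addr0.
rewrite -expR_sum ler_expR -mulr_sumr.
have -> : C * m%:R = l * (C * n%:R) by rewrite /l; field; rewrite gt_eqF.
by rewrite ler_wpM2l // ltW.
Qed.

End TetrahedralMonomials.

(** * The point [v] obtained from 2-convexity *)

Section TwoConvexity.
Variables (R : realType) (n : nat) (q : ('I_n -> R[i]) -> R) (M : R).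
Hypothesis q_norm : lattice_norm q.
Hypothesis q_convex : forall N (x : 'I_N -> 'I_n -> R[i]),
  q (fun k => rC (Num.sqrt (\sum_j cabs (x j k) ^+ 2)))
    <= M * Num.sqrt (\sum_j q (x j) ^+ 2).

Lemma norm_gt0 z i : z i != 0 -> 0 < q z.
Proof.
move=> zi; have [_ _ e0] := q_norm.
apply: (@lt_le_trans _ _ (q (fun j => z i * (j == i)%:R))).
  by rewrite (norm_scale q_norm) mulr_gt0 ?cabs_gt0.
apply: (norm_solid q_norm) => j.
by case: eqVneq => [->|_]; rewrite ?mulr1 ?mulr0 ?cabs0 ?cabs_ge0.
Qed.

(** The vector [u] is a convex combination of squared moduli of points of the ball, and 2-convexity
    bounds the norm of [w = sqrt u] by [M]. Dividing by [2 M] rather than [M] reaches the open ball,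
    and turns the constant 6 into [6 * 4 M^2]. *)
Lemma exists_dominating_point : (0 < n)%N -> exists v : 'I_n -> R[i],
  [/\ q v < 1, forall i, v i != 0 &
      forall z, q z < 1 -> \sum_i (cabs (z i) / cabs (v i)) ^+ 2 <= 24 * M ^+ 2 * n%:R].
Proof.
move=> n0; have [D D1 zD] := ball_bounded q_norm.
have [t t0 t1] := exists_positive_point q_norm.
have [|||N [nu [zz [nu0 zz1 nu1 u0 le6]]]] :=
    @lozanovskii R _ 'I_n [set z | q z < 1] (fun z i => cabs (z i) ^+ 2) (D ^+ 2).
- by rewrite card_ord.
- move=> z i z1; rewrite sqr_ge0 lerXn2r ?nnegrE ?cabs_ge0 ?zD //.
  exact: le_trans ler01 D1.
- by exists (fun=> rC t); split=> // i; rewrite exprn_gt0 // cabs_rC_ge0 // ltW.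
pose u i := \sum_j nu j * cabs (zz j i) ^+ 2.
have {}u0 i : 0 < u i := u0 i.
pose x j k : R[i] := rC (Num.sqrt (nu j)) * zz j k.
pose w i : R[i] := rC (Num.sqrt (u i)).
have w0 i : w i != 0 by rewrite fmorph_eq0 gt_eqF // sqrtr_gt0.
have wE : w = (fun k => rC (Num.sqrt (\sum_j cabs (x j k) ^+ 2))).
  apply/funext => k; congr (rC (Num.sqrt _)); apply: eq_bigr => j _.
  by rewrite cabsM exprMn cabs_rC_ge0 ?sqrtr_ge0 // sqr_sqrtr.
have le1 : Num.sqrt (\sum_j q (x j) ^+ 2) <= 1.
  rewrite -[X in _ <= X]sqrtr1 ler_wsqrtr // -nu1; apply: ler_sum => j _.
  rewrite (norm_scale q_norm) exprMn cabs_rC_ge0 ?sqrtr_ge0 // sqr_sqrtr //.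
  by rewrite ler_piMr // exprn_ile1 ?(norm_ge0 q_norm) // ltW // zz1.
have qw_gt0 : 0 < q w := norm_gt0 (w0 (Ordinal n0)).
have qw_le : q w <= M * Num.sqrt (\sum_j q (x j) ^+ 2) by rewrite wE.
have M0 : 0 < M.
  have := lt_le_trans qw_gt0 qw_le; rewrite pmulr_lgt0 // lt0r sqrtr_ge0 andbT.
  apply: contraTneq (lt_le_trans qw_gt0 qw_le) => ->; by rewrite mulr0 ltxx.
have qw_leM : q w <= M by apply: le_trans qw_le _; rewrite ler_piMr // ltW.
have M20 : 0 < (2 * M)^-1 by rewrite invr_gt0 mulr_gt0.
exists (fun i => rC (2 * M)^-1 * w i); split=> [|i|z z1].
- rewrite (norm_scale q_norm) cabs_rC_ge0 ?(ltW M20) // mulrC ltr_pdivrMr ?mulr_gt0 //.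
  by rewrite mul1r; lra.
- by rewrite mulf_neq0 // fmorph_eq0 gt_eqF.
have := le6 z z1; rewrite card_ord => {}le6.
have -> : \sum_i (cabs (z i) / cabs (rC (2 * M)^-1 * w i)) ^+ 2 =
    4 * M ^+ 2 * \sum_i cabs (z i) ^+ 2 / u i.
  rewrite mulr_sumr; apply: eq_bigr => i _.
  rewrite cabsM !cabs_rC_ge0 ?(ltW M20) ?sqrtr_ge0 //.
  rewrite expr_div_n exprMn sqr_sqrtr ?(ltW (u0 i)) //.
  by field; rewrite !gt_eqF ?u0.
apply: le_trans (ler_wpM2l _ le6) _; first by rewrite mulr_ge0 ?sqr_ge0.
by rewrite le_eqVlt; apply/orP; left; apply/eqP; ring.
Qed.

End TwoConvexity.

(** * Random polynomials of small sup norm *)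

Lemma card_same_multiplicities (T : finType) p (s : {ffun 'I_p -> T}) :
  (#|[pred s' : {ffun 'I_p -> T} |
      [forall a, #|[pred j | s j == a]| == #|[pred j | s' j == a]|]]| <= p`!)%N.
Proof.
(* Words with the same letter counts are rearrangements of each other. *)
pose phi (g : 'S_p) : {ffun 'I_p -> T} := [ffun j => s (g j)].
rewrite -(card_Sn p) -cardsT.
apply: leq_trans (leq_imset_card phi _); apply: subset_leq_card.
apply/fintype.subsetP => s' /=; rewrite inE => /forallP same.
have cnt (f : {ffun 'I_p -> T}) a :
    count_mem a [tuple f j | j < p] = #|[pred j | f j == a]|.
  by rewrite /= count_map cardE size_filter enumT; apply: eq_count => j.
have /tuple_permP [g gE] : perm_eq [tuple s' j | j < p] [tuple s j | j < p].
  by apply/allP => a _ /=; rewrite !cnt eq_sym.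
apply/imsetP; exists g; rewrite ?inE //; apply/ffunP => j; rewrite ffunE.
have := congr1 (fun r : seq T => nth (s j) r j) gE.
by rewrite -!tnth_nth !tnth_mktuple.
Qed.

Section KahaneSalemZygmund.
Variables (R : realType) (n m p : nat) (S : {set MI n m}).
Hypothesis S_deg : forall a, a \in S -> (mdeg a <= m)%N.

Let key (s : {ffun 'I_p -> MI n m}) : MI n (p * m) :=
  [ffun i => inord (\sum_j s j i)].

Let keyE s i : key s i = (\sum_j s j i)%N :> nat.
Proof.
rewrite ffunE inordK // ltnS -[X in (_ <= X * _)%N]card_ord -sum_nat_const.
by apply: leq_sum => j _; rewrite -ltnS.
Qed.

Let inS (s : {ffun 'I_p -> MI n m}) := [forall j, s j \in S].

Let key_deg s : inS s -> (mdeg (key s) <= p * m)%N.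
Proof.
move=> /forallP sS; rewrite /mdeg; under eq_bigr => i _ do rewrite keyE.
rewrite exchange_big -[X in (_ <= X * _)%N]card_ord -sum_nat_const.
by apply: leq_sum => j _; apply: S_deg.
Qed.

Let monom_key s (y : 'I_n -> R[i]) : monom (key s) y = \prod_j monom (s j) y.
Proof.
rewrite /monom exchange_big; apply: eq_bigr => i _ /=.
by rewrite keyE -prodrXr.
Qed.

Let keys := [set g : MI n (p * m) | [exists s, inS s && (key s == g)]]%SET.

Let mult (g : MI n (p * m)) : R := #|[pred s | inS s && (key s == g)]|%:R.

Let mult_gt0 g : g \in keys -> 0 < mult g.
Proof.
rewrite inE => /existsP[s h]; rewrite ltr0n; apply/card_gt0P; exists s.
by rewrite inE.
Qed.

Let card_keys : (#|keys| <= #|[pred g : MI n (p * m) | (mdeg g <= p * m)%N]|)%N.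
Proof.
apply: subset_leq_card; apply/fintype.subsetP => g; rewrite !inE.
by move=> /existsP[s /andP[/key_deg sS /eqP <-]].
Qed.

Let sum_keys (f : {ffun 'I_p -> MI n m} -> R[i]) :
  \sum_(s | inS s) f s = \sum_(g in keys) \sum_(s | inS s && (key s == g)) f s.
Proof.
apply: (partition_big key) => s sS; rewrite inE; apply/existsP; exists s.
by rewrite sS eqxx.
Qed.

(* The [p]-th power of the random polynomial is expanded over [p]-tuples of
   monomials, grouped by their product; the random coefficients of the groups
   are controlled in mean square, independently of the point [y]. *)
Lemma exists_flat_signs : exists eps : MI n m -> R[i],
  (forall a, cabs (eps a) = 1) /\
  forall y : 'I_n -> R[i],
    (cabs (\sum_(a in S) eps a * monom a y) ^+ 2) ^+ p <=
      (p`! * #|[pred g : MI n (p * m) | (mdeg g <= p * m)%N]|)%:R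
        * (\sum_(a in S) cabs (monom a y) ^+ 2) ^+ p.
Proof.
(* Roots of order [p.+1] suffice for the random coefficients, since each occurs with exponent at
   most [p] in the [p]-th power. *)
pose Th := {ffun MI n m -> 'I_p.+1}.
pose e (s : {ffun 'I_p -> MI n m}) a := #|[pred j | s j == a]|.
have e_le s a : (e s a <= p)%N by rewrite -[X in (_ <= X)%N](card_ord p) max_card.
have chiE s (th : Th) : chi R (e s) th = \prod_j rot R th (s j).
  rewrite /chi (partition_big s xpredT) //=; apply: eq_bigr => a _.
  rewrite (eq_bigr (fun=> rot R th a)) => [|j /eqP -> //].
  by rewrite prodr_const.
pose E g (th : Th) := \sum_(s | inS s && (key s == g)) chi R (e s) th.
have E_le g : avg (fun th => cabs (E g th) ^+ 2) <= p`!%:R * mult g.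
  pose x s : R[i] := (inS s && (key s == g))%:R.
  have -> : avg (fun th => cabs (E g th) ^+ 2)
      = avg (fun th : Th => cabs (\sum_s x s * chi R (e s) th) ^+ 2).
    apply: eq_avg => th; rewrite /E big_mkcond; congr (cabs _ ^+ 2).
    by apply: eq_bigr => s _; rewrite /x; case: ifP; rewrite ?mul1r ?mul0r.
  apply: le_trans (@parseval_le R _ p _ e x p`! _ _) _ => //.
    by move=> s _; apply: card_same_multiplicities.
  rewrite ler_wpM2l // /mult -sumr_const [X in _ <= X]big_mkcond.
  apply: ler_sum => s _; rewrite inE /x.
  by case: ifP; rewrite ?cabs1 ?cabs0 ?expr1n ?expr0n.
(* The choice of [th] precedes that of [y]: one mean-square bound, weighted by [mult], controls all
   groups at once and thus every point. *)
have [th thP] := exists_le_avg (card_rot_gt0 _ _)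
  (fun th : Th => \sum_(g in keys) cabs (E g th) ^+ 2 / mult g).
exists (rot R th); split=> [a|y]; first exact: cabs_rot.
have sumE : \sum_(g in keys) cabs (E g th) ^+ 2 / mult g <=
    (p`! * #|[pred g : MI n (p * m) | (mdeg g <= p * m)%N]|)%:R.
  apply: le_trans thP _; rewrite avg_suml.
  apply: (@le_trans _ _ (\sum_(g in keys) p`!%:R)).
    apply: ler_sum => g gk; under eq_avg => w do rewrite mulrC.
    by rewrite avgZ mulrC ler_pdivrMr ?mult_gt0.
  by rewrite sumr_const -[X in X <= _]mulr_natr -natrM ler_nat leq_mul.
have powE (f : MI n m -> R[i]) :
    (\sum_(a in S) f a) ^+ p = \sum_(s | inS s) \prod_j f (s j).
  rewrite big_mkcond -[p in _ ^+ p]card_ord -prodr_const.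
  rewrite (bigA_distr_bigA (fun (j : 'I_p) a => if a \in S then f a else 0)).
  rewrite [RHS]big_mkcond; apply: eq_bigr => s _.
  case: ifPn => [/forallP sS|]; first by apply: eq_bigr => j _; rewrite sS.
  by rewrite negb_forall => /existsP[j /negPf sj]; rewrite (bigD1 j) //= sj mul0r.
have -> : (\sum_(a in S) cabs (monom a y) ^+ 2) ^+ p
    = \sum_(g in keys) mult g * cabs (monom g y) ^+ 2.
  apply: rC_inj; rewrite rmorphXn rmorph_sum powE sum_keys rmorph_sum.
  apply: eq_bigr => g _ /=; rewrite rmorphM rmorph_nat mulr_natl -sumr_const.
  apply: eq_big => [s|s /andP[_ /eqP <-]]; first by rewrite inE.
  by rewrite monom_key cabs_prod -prodrXl rmorph_prod.
apply: le_trans (_ : _ <= (\sum_(g in keys) cabs (E g th) ^+ 2 / mult g) *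
  (\sum_(g in keys) mult g * cabs (monom g y) ^+ 2)) _; last first.
  apply: ler_wpM2r => //; apply: sumr_ge0 => g _.
  by rewrite mulr_ge0 ?sqr_ge0.
rewrite -exprM mulnC exprM -cabsX powE sum_keys.
have -> : \sum_(g in keys) \sum_(s | inS s && (key s == g))
    \prod_j (rot R th (s j) * monom (s j) y) = \sum_(g in keys) E g th * monom g y.
  apply: eq_bigr => g _; rewrite mulr_suml; apply: eq_bigr => s /andP[_ /eqP <-].
  by rewrite big_split monom_key chiE.
(* The weights [mult g] are forced by the second factor: [sum_g mult g |y^g|^2] is exactly the
   [p]-th power of [sum_a |y^a|^2]. *)
apply: (@le_trans _ _ ((\sum_(g in keys) (cabs (E g th) / Num.sqrt (mult g)) *
    (Num.sqrt (mult g) * cabs (monom g y))) ^+ 2)).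
  rewrite lerXn2r ?nnegrE ?cabs_ge0 //.
    by apply: sumr_ge0 => g _; rewrite !mulr_ge0 ?invr_ge0 ?sqrtr_ge0 ?cabs_ge0.
  apply: le_trans (cabs_sum _ _ _) _; apply: ler_sum => g gk.
  by rewrite cabsM mulrA divfK // gt_eqF // sqrtr_gt0 mult_gt0.
apply: le_trans (cauchy_schwarz _ _ _) _.
rewrite le_eqVlt; apply/orP; left; apply/eqP; congr (_ * _); apply: eq_bigr => g gk.
  by rewrite expr_div_n sqr_sqrtr // ltW // mult_gt0.
by rewrite exprMn sqr_sqrtr // ltW // mult_gt0.
Qed.

End KahaneSalemZygmund.

(** Take [p = n]. Then [p! <= n^n], and the generating function at [1/2] bounds the number of
    monomials of degree at most [n m] by [2^(n (m + 1))]; [n]-th roots leave [n 2^(m + 1)]. *)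
Lemma exists_flat_polynomial (R : realType) n m (S : {set MI n m}) : (0 < n)%N ->
  (forall a, a \in S -> (mdeg a <= m)%N) ->
  exists eps : MI n m -> R[i], (forall a, cabs (eps a) = 1) /\
  forall y : 'I_n -> R[i],
    cabs (\sum_(a in S) eps a * monom a y) ^+ 2 <=
      n%:R * 2 ^+ m.+1 * \sum_(a in S) cabs (monom a y) ^+ 2.
Proof.
move=> n0 S_deg; have [eps [eps1 flat]] := exists_flat_signs R n S_deg.
have fact_le : (n`! <= n ^ n)%N.
  rewrite -ffactnn ffact_prod.
  have -> : (n ^ n = \prod_(i < n) n)%N by rewrite prod_nat_const card_ord.
  by apply: leq_prod => i _; apply: leq_subr.
exists eps; split=> // y.
have s0 : 0 <= \sum_(a in S) cabs (monom a y) ^+ 2.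
  by apply: sumr_ge0 => a _; apply: sqr_ge0.
rewrite -(@ler_pXn2r _ n) ?nnegrE ?sqr_ge0 //; last first.
  by rewrite !mulr_ge0 ?exprn_ge0.
apply: le_trans (flat y) _; rewrite [X in _ <= X]exprMn ler_wpM2r ?exprn_ge0 //.
have := @card_mdeg_le R n (n * m) (n * m) 2^-1.
rewrite invr_gt0 ltr0n invf_lt1 ?ltr1n ?ltr0n // => /(_ isT).
have -> : (1 - 2^-1 : R)^-1 = 2 by field.
rewrite exprVn ler_pdivrMr ?exprn_gt0 // -exprD => h.
rewrite exprMn natrM; apply: ler_pM => //; first by rewrite -natrX ler_nat.
by rewrite -exprM mulSn (mulnC m).
Qed.

(** * Passage from sequence lattices and index sets to the finite setting *)

Section SequenceLattice.
Variables (R : realType) (Xm : set (cseq R)) (nX : cseq R -> R).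
Hypothesis X_lattice : is_banach_seq_lattice Xm nX.
Variable n : nat.

Let ext (z : 'I_n -> R[i]) : cseq R :=
  fun k => if insub k is Some i then rC (cabs (z i)) else 0.

Let ext_in z : Xm (ext z).
Proof.
have [[X0 XD XZ] _ _ _ Xe] := X_lattice.
suff h k : Xm (fun j => if (j < k)%N then ext z j else 0).
  have -> : ext z = (fun j => if (j < n)%N then ext z j else 0); last exact: h.
  by apply/funext => j; rewrite /ext; case: insubP => [i -> _|/negPf ->].
elim: k => [|k IH]; first exact: X0.
have -> : (fun j => if (j < k.+1)%N then ext z j else 0)
    = (fun j => (if (j < k)%N then ext z j else 0) + ext z k * unitseq k j).
  apply/funext => j; rewrite ltnS /unitseq; case: ltngtP => [||->];
    by rewrite ?mulr0 ?mulr1 ?addr0 ?add0r.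
by apply: XD => //; apply/XZ/Xe.
Qed.

Let nX_ge0 x : Xm x -> 0 <= nX x.
Proof.
have [[X0 _ _] [_ nXZ _] _ Xsolid _] := X_lattice.
move=> Xx; have [|_] := Xsolid x (fun=> 0) Xx; first by move=> k; rewrite cabs0 cabs_ge0.
have -> : (fun=> 0) = (fun k : nat => 0 * (0 : R[i])) by rewrite mul0r.
by rewrite nXZ // cabs0 mul0r.
Qed.

Lemma Xn_lattice_norm : lattice_norm (@Xn_norm R nX n).
Proof.
have [[X0 XD XZ] [_ nXZ nX_eq0] _ Xsolid Xe] := X_lattice.
split.
- move=> y z yz; have [|_] := Xsolid (ext z) (ext y) (ext_in z); last by [].
  move=> k; rewrite /ext; case: insubP => // i _ _.
  by rewrite !cabs_rC_ge0 ?cabs_ge0.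
- move=> a z; rewrite -(cabs_rC_ge0 (cabs_ge0 a)) -(nXZ _ _ (ext_in z)).
  rewrite /Xn_norm; congr nX; apply/funext => k.
  rewrite /ext; case: insubP => [i _ _|_]; last by rewrite mulr0.
  by rewrite cabsM rmorphM.
- move=> i; have -> : Xn_norm nX n (fun j => (j == i)%:R) = nX (unitseq i).
    congr nX; apply/funext => k; rewrite /unitseq.
    case: insubP => [j _ <-|kn]; last first.
      by case: eqP kn => // ->; rewrite ltn_ord.
    by rewrite val_eqE; case: eqP; rewrite ?cabs1 ?cabs0 ?rmorph1 ?rmorph0.
  rewrite lt0r nX_ge0 // andbT; apply/eqP => /nX_eq0 => /(_ (Xe _)).
  move=> /(congr1 (fun x : cseq R => x i)); rewrite /unitseq eqxx => /eqP.
  by rewrite oner_eq0.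
Qed.

Lemma Xn_two_convex M : two_convex Xm nX M ->
  forall N (x : 'I_N -> 'I_n -> R[i]),
    Xn_norm nX n (fun k => rC (Num.sqrt (\sum_j cabs (x j k) ^+ 2)))
      <= M * Num.sqrt (\sum_j Xn_norm nX n (x j) ^+ 2).
Proof.
move=> conv N x; apply: le_trans (conv N (fun j => ext (x j)) (fun j => ext_in _)).
rewrite le_eqVlt; apply/orP; left; apply/eqP; congr nX; apply/funext => k.
rewrite /ext; case: insubP => [i _ _|_]; last first.
  by rewrite big1 ?sqrtr0 ?rmorph0 // => j _; rewrite cabs0 expr0n.
rewrite cabs_rC_ge0 ?sqrtr_ge0 //; congr (rC (Num.sqrt _)).
by apply: eq_bigr => j _; rewrite cabs_rC_ge0 ?cabs_ge0.
Qed.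

End SequenceLattice.

Section IndexSets.
Variables (R : realType) (J : set mindex) (n m : nat).
Hypothesis J_deg : deg_at_most J m.

Definition index_finset : {set MI n m} := [set a : MI n m | `[< J (mi_ext a) >]]%SET.

Lemma inPJ_supported (c : MI n m -> R[i]) : inPJ J c <-> supported index_finset c.
Proof.
split=> h a; first by rewrite inE => /asboolPn /h.
by move=> Ja; apply: h; rewrite inE; apply/asboolPn.
Qed.

Lemma sum_mi_ext (a : MI n m) : (\sum_(k < n) mi_ext a k)%N = mdeg a.
Proof.
apply: eq_bigr => i _; rewrite /mi_ext; case: insubP => [j _ /val_inj -> //|].
by rewrite ltn_ord.
Qed.

Lemma index_finset_deg a : a \in index_finset -> (mdeg a <= m)%N.
Proof. by rewrite inE => /asboolP /J_deg /(_ n); rewrite sum_mi_ext. Qed.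

Lemma index_finset_neq0 : (exists a, J a /\ forall k, (n <= k)%N -> a k = 0%N) ->
  index_finset != finset.set0.
Proof.
move=> [a [Ja an]]; apply/set0Pn.
have am k : (a k <= m)%N.
  apply: leq_trans (J_deg Ja k.+1).
  by rewrite big_ord_recr leq_addl.
exists [ffun i : 'I_n => inord (a i)]; rewrite inE; apply/asboolP.
have -> // : mi_ext ([ffun i : 'I_n => inord (a i)] : MI n m) = a.
apply/funext => k; rewrite /mi_ext; case: insubP => [i _ <-|].
  by rewrite ffunE inordK // ltnS.
by rewrite -leqNgt => /an.
Qed.

Lemma tetrahedral_sub : LambdaT m `<=` J -> tetrahedral n m \subset index_finset.
Proof.
move=> sub; apply/fintype.subsetP => a /tetrahedralP[a1 am].
rewrite inE; apply/asboolP/sub; split.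
  by move=> k; rewrite /mi_ext; case: insubP.
exists n; split; last by rewrite sum_mi_ext.
by move=> k nk; rewrite /mi_ext; case: insubP => // i; rewrite ltnNge nk.
Qed.

End IndexSets.

(** * The two constants as suprema and infima *)

Section Constants.
Variables (R : realType) (Xm : set (cseq R)) (nX : cseq R -> R) (J : set mindex).
Variables (n m : nat).
Hypothesis X_lattice : is_banach_seq_lattice Xm nX.
Hypothesis J_deg : deg_at_most J m.
Hypothesis J_neq0 : exists a, J a /\ forall k, (n <= k)%N -> a k = 0%N.

Let q := @Xn_norm R nX n.
Let S := index_finset J n m.
Let q_norm : lattice_norm q := Xn_lattice_norm X_lattice n.
Let S_neq0 : S != finset.set0 := index_finset_neq0 J_deg J_neq0.

Let pnormE (c : MI n m -> R[i]) : pnorm nX c = supnorm q c.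
Proof. by []. Qed.

Let delta (b : MI n m) : MI n m -> R[i] := fun a => (a == b)%:R.

Let delta_gt0 b : 0 < supnorm q (delta b).
Proof. by apply: (supnorm_gt0 q_norm (b := b)); rewrite /delta eqxx oner_eq0. Qed.

Let delta_in b : b \in S -> inPJ J (delta b).
Proof.
move=> bS; apply/inPJ_supported => a aS; rewrite /delta.
by case: eqP aS => // ->; rewrite bS.
Qed.

(** Since [sup] has a default value on empty or unbounded sets, estimates of [chi_mon] rest on both
    a member (the ratio 1) and an upper bound of this set. *)
Let unconditionality_ratios := [set r : R | exists (c eps : MI n m -> R[i]),
  [/\ inPJ J c, (forall a, cabs (eps a) <= 1), 0 < pnorm nX c &
      r = pnorm nX (fun a => eps a * c a) / pnorm nX c]].

Let ratios1 : unconditionality_ratios 1.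
Proof.
have [b bS] := set0Pn _ S_neq0.
exists (delta b), (fun=> 1); split; rewrite ?pnormE //.
- exact: delta_in.
- by move=> a; rewrite cabs1.
- have -> : (fun a => 1 * delta b a) = delta b by apply/funext => a; rewrite mul1r.
  by rewrite divff // gt_eqF.
Qed.

Let ratios_le r : unconditionality_ratios r -> r <=
  1 + 2 ^+ m * (Num.sqrt #|[pred a : MI n m | (mdeg a <= m.-1)%N]|%:R * (4 * 2 ^+ m)).
Proof.
move=> [c [eps [/inPJ_supported cS eps1 c0 ->]]]; rewrite ler_pdivrMr //.
apply: multiplier_supnorm_le => // a ca.
by apply: (index_finset_deg J_deg); apply: contraNT ca => /cS ->.
Qed.

Lemma chi_mon_le : chi_mon nX J n m <=
  1 + 2 ^+ m * (Num.sqrt #|[pred a : MI n m | (mdeg a <= m.-1)%N]|%:R * (4 * 2 ^+ m)).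
Proof. by apply: ge_sup => //; exists 1. Qed.

Lemma ratio_le_chi_mon (c eps : MI n m -> R[i]) : inPJ J c ->
  (forall a, cabs (eps a) <= 1) -> 0 < pnorm nX c ->
  pnorm nX (fun a => eps a * c a) / pnorm nX c <= chi_mon nX J n m.
Proof.
move=> cJ eps1 c0; apply: ub_le_sup; last by exists c, eps.
by eexists => r /ratios_le; apply.
Qed.

Lemma chi_mon_ge1 : 1 <= chi_mon nX J n m.
Proof. by apply: ub_le_sup; [eexists => r /ratios_le; apply | exact: ratios1]. Qed.

Let isometric (Z : lmodType R[i]) (nZ : Z -> R) (iota : MI n m -> Z) :=
  forall c : MI n m -> R[i], inPJ J c -> nZ (\sum_(a : MI n m) c a *: iota a) = pnorm nX c.

Let projection_bounds (Z : lmodType R[i]) (nZ : Z -> R) (iota : MI n m -> Z) :=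
  [set K : R | exists P : Z -> Z,
    [/\ (forall (a : R[i]) (x y : Z), P (a *: x + y) = a *: P x + P y),
        (forall x : Z, exists2 c : MI n m -> R[i], inPJ J c &
             P x = \sum_(a : MI n m) c a *: iota a),
        (forall c : MI n m -> R[i], inPJ J c ->
             P (\sum_(a : MI n m) c a *: iota a) = \sum_(a : MI n m) c a *: iota a) &
        (forall x : Z, nZ (P x) <= K * nZ x)]].

Let projection_boundsP (Z : lmodType R[i]) (nZ : Z -> R) (iota : MI n m -> Z) :
  is_cnorm nZ -> isometric nZ iota ->
  projection_bounds nZ iota (Num.sqrt (6 * #|S|%:R)).
Proof.
move=> nZ_norm isom.
have isom' c : supported S c -> nZ (\sum_a c a *: iota a) = supnorm q c.
  by move=> /inPJ_supported; apply: isom.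
have [P [Plin Prange Pfix Ple]] := exists_projection q_norm S_neq0 nZ_norm isom'.
exists P; split=> // [x|c /inPJ_supported]; last exact: Pfix.
by have [c /inPJ_supported cJ ->] := Prange x; exists c.
Qed.

Let projection_bounds_ge1 (Z : lmodType R[i]) (nZ : Z -> R) (iota : MI n m -> Z) K :
  isometric nZ iota -> projection_bounds nZ iota K -> 1 <= K.
Proof.
move=> isom [P [_ _ Pfix Ple]].
apply: (projection_bound_ge1 q_norm S_neq0 _ _ Ple) => c /inPJ_supported.
  exact: isom.
exact: Pfix.
Qed.

Lemma rel_proj_const_le (Z : lmodType R[i]) (nZ : Z -> R) (iota : MI n m -> Z) :
  is_cnorm nZ -> isometric nZ iota ->
  rel_proj_const nX J n m Z nZ iota <= Num.sqrt (6 * #|S|%:R).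
Proof.
move=> nZ_norm isom; apply: ge_inf; last exact: projection_boundsP.
by exists 1 => K; apply: projection_bounds_ge1.
Qed.

Let Z := bfun R (ball_point q).
Let iota (a : MI n m) : Z := monom_fun q a.

Let iota_isometric : isometric (@bnorm R (ball_point q)) iota.
Proof. by move=> c _; apply: bnorm_sum_monom_fun. Qed.

Let Z_cnorm : is_cnorm (@bnorm R (ball_point q)).
Proof. exact: (bnorm_cnorm _ (origin q_norm)). Qed.

Let rel_le_proj_const :
  rel_proj_const nX J n m Z (@bnorm R (ball_point q)) iota <= proj_const nX J n m.
Proof.
apply: ub_le_sup; last by exists Z, (@bnorm R (ball_point q)), iota.
exists (Num.sqrt (6 * #|S|%:R)) => _ [Z' [nZ' [iota' [nZ_norm isom ->]]]].
exact: rel_proj_const_le.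
Qed.

Lemma proj_const_le : proj_const nX J n m <= Num.sqrt (6 * #|S|%:R).
Proof.
apply: ge_sup => [|_ [Z' [nZ' [iota' [nZ_norm isom ->]]]]].
  by eexists; exists Z, (@bnorm R (ball_point q)), iota; split.
exact: rel_proj_const_le.
Qed.

(** The projection constant is a supremum over superspaces, so the bounded functions on the ball
    alone give a lower bound. There [1 <= K] holds because a projection fixes a nonzero
    polynomial. *)
Lemma proj_const_ge (B : R) :
  (forall (P : Z -> Z) (K : R), 1 <= K ->
     (forall a x y, P (a *: x + y) = a *: P x + P y) ->
     (forall x, exists2 c, supported S c & P x = \sum_a c a *: iota a) ->
     (forall c, supported S c -> P (\sum_a c a *: iota a) = \sum_a c a *: iota a) ->
     (forall x, bnorm (P x) <= K * bnorm x) -> B <= K) ->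
  B <= proj_const nX J n m.
Proof.
move=> h; apply: le_trans _ rel_le_proj_const.
apply: lb_le_inf.
  by exists (Num.sqrt (6 * #|S|%:R)); apply: projection_boundsP.
move=> K bK; have K1 := projection_bounds_ge1 iota_isometric bK.
have [P [Plin Prange Pfix Ple]] := bK.
apply: (h P K K1) => // [x|c /inPJ_supported]; last exact: Pfix.
by have [c /inPJ_supported cJ ->] := Prange x; exists c.
Qed.

End Constants.

(** Used with [x = exp 1] and [y = exp (24 M^2)]. In order, the inequalities serve both lower bounds
    for [m <= n], the upper bound of the projection constant, that of the unconditional constant,
    and the case [n < m]. *)
Lemma constant_bounds (R : realType) (x y : R) : 1 <= x -> 1 <= y ->
  [/\ 128 * y <= (32 * x * y) ^+ 2, 6 * x <= (32 * x * y) ^+ 2,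
      20 * x <= 32 * x * y & 2 <= (32 * x * y) ^+ 2].
Proof.
move=> x1 y1; have xy0 : 0 <= (x - 1) * (y - 1) by rewrite mulr_ge0 ?subr_ge0.
have -> : 32 * x * y = 32 * (x * y) by ring.
move: xy0; rewrite mulrBr mulrBl mulrBl !mul1r mulr1 exprMn; set p := x * y => xy0.
have p1 : 0 <= (p - 1) * p by rewrite mulr_ge0; lra.
by rewrite expr2; split; lra.
Qed.

(** * The four estimates *)

Section Bounds.
Variables (R : realType) (M : R) (Xm : set (cseq R)) (nX : cseq R -> R) (J : set mindex).
Variables (n m : nat).
Hypothesis X_lattice : is_banach_seq_lattice Xm nX.
Hypothesis X_convex : two_convex Xm nX M.
Hypothesis J_deg : deg_at_most J m.
Hypothesis J_neq0 : exists a, J a /\ forall k, (n <= k)%N -> a k = 0%N.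
Hypotheses (n0 : (0 < n)%N) (m0 : (0 < m)%N).
Hypothesis J_LambdaT : LambdaT m `<=` J.

Let q := @Xn_norm R nX n.
Let S := index_finset J n m.
Let q_norm : lattice_norm q := Xn_lattice_norm X_lattice n.
Let T : R := 1 + n%:R / m%:R.
Let rho : R := (n%:R / m%:R) ^+ m.
Let e1 : R := expR 1.
Let E : R := expR (24 * M ^+ 2).
Let C : R := 32 * e1 * E.

Let n0' : 0 < (n%:R : R). Proof. by rewrite ltr0n. Qed.
Let m0' : 0 < (m%:R : R). Proof. by rewrite ltr0n. Qed.
Let m_neq0 : (m%:R : R) != 0. Proof. by rewrite gt_eqF. Qed.
Let nm0 : 0 < (n%:R / m%:R : R). Proof. by rewrite divr_gt0. Qed.
Let T1 : 1 <= T. Proof. by rewrite lerDl ltW. Qed.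
Let T0 : 0 < T. Proof. exact: lt_le_trans ltr01 T1. Qed.
Let rho0 : 0 < rho. Proof. by rewrite exprn_gt0. Qed.
Let e1_ge1 : 1 <= e1. Proof. by rewrite -expR0 ler_expR. Qed.
Let E_ge1 : 1 <= E.
Proof. by rewrite -expR0 ler_expR mulr_ge0 ?sqr_ge0. Qed.
Let e10 : 0 < e1. Proof. exact: expR_gt0. Qed.
Let E0 : 0 < E. Proof. exact: expR_gt0. Qed.
Let C0 : 0 < C. Proof. by rewrite !mulr_gt0. Qed.
Let e1E : expR (m%:R : R) = e1 ^+ m.
Proof. by rewrite -expRM_natl mulr1. Qed.

(** Half-integer powers are eliminated throughout by comparing squares. *)
Let powR_half k : (T `^ (k%:R / 2)) ^+ 2 = T ^+ k.
Proof.
by rewrite -powR_mulrn ?powR_ge0 // -powRrM divfK ?pnatr_eq0 // powR_mulrn // ltW.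
Qed.

Let le_sqr (x y : R) : 0 <= y -> x ^+ 2 <= y ^+ 2 -> x <= y.
Proof.
move=> y0; case: (lerP 0 x) => x0; last by move=> _; rewrite ltW // (lt_le_trans x0).
by rewrite ler_pXn2r.
Qed.

Let C_big : [/\ 128 * E <= C ^+ 2, 6 * e1 <= C ^+ 2, 20 * e1 <= C & 2 <= C ^+ 2].
Proof. exact: constant_bounds. Qed.

Let expr_le (k : nat) (x y : R) : 0 <= x -> x <= y -> x ^+ k <= y ^+ k.
Proof. by move=> x0 xy; rewrite lerXn2r // nnegrE // (le_trans x0). Qed.

Let le_expr_m (x : R) : 1 <= x -> x <= x ^+ m.
Proof. by move=> x1; rewrite -[X in X <= _]expr1 ler_weXn2l. Qed.

Lemma proj_const_upper : proj_const nX J n m <= C ^+ m * T `^ (m%:R / 2).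
Proof.
apply: le_trans (proj_const_le X_lattice J_deg J_neq0) _.
apply: le_sqr; first by rewrite mulr_ge0 ?powR_ge0 ?exprn_ge0 // ltW.
rewrite sqr_sqrtr ?mulr_ge0 // exprMn powR_half exprAC.
have cardS : (#|S|%:R : R) <= T ^+ m * e1 ^+ m.
  rewrite -e1E; apply: le_trans (card_mdeg_le_exp R m n0 m0); rewrite ler_nat.
  apply: subset_leq_card; apply/fintype.subsetP => a /(index_finset_deg J_deg).
  by rewrite inE.
apply: le_trans (ler_wpM2l _ cardS) _ => //.
rewrite mulrCA mulrC ler_wpM2r ?exprn_ge0 ?(ltW T0) //.
apply: (@le_trans _ _ ((6 * e1) ^+ m)); last first.
  by have [_ h _ _] := C_big; apply: expr_le h; rewrite mulr_ge0 // ltW.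
rewrite exprMn ler_wpM2r ?exprn_ge0 ?(ltW e10) // le_expr_m //.
by rewrite ler1n.
Qed.

Lemma chi_mon_upper : chi_mon nX J n m <= C ^+ m * T `^ (m.-1%:R / 2).
Proof.
apply: le_trans (chi_mon_le X_lattice J_deg J_neq0) _.
set Tc := T `^ _; have Tc0 : 0 <= Tc by rewrite powR_ge0.
have Tc1 : 1 <= Tc.
  apply: le_sqr => //; rewrite powR_half expr1n; exact: exprn_ege1.
set cnt := #|_|; have sq : Num.sqrt cnt%:R <= Tc * e1 ^+ m.
  apply: le_sqr; first by rewrite mulr_ge0 ?exprn_ge0 // ltW.
  rewrite sqr_sqrtr // exprMn powR_half.
  apply: le_trans (card_mdeg_le_exp R m.-1 n0 m0) _; rewrite e1E -/T.
  rewrite ler_wpM2l ?exprn_ge0 ?(ltW T0) // expr2 ler_peMl ?exprn_ge0 ?(ltW e10) //.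
  exact: exprn_ege1.
have p0 : 0 <= (2 ^+ m : R) by rewrite exprn_ge0.
apply: (@le_trans _ _ (Tc * (1 + 4 * (4 * e1) ^+ m))).
  have -> : Tc * (1 + 4 * (4 * e1) ^+ m) = Tc + 2 ^+ m * ((Tc * e1 ^+ m) * (4 * 2 ^+ m)).
    rewrite (_ : 4 * e1 = 2 * 2 * e1); last by ring.
    by rewrite !exprMn; ring.
  by rewrite lerD // ler_wpM2l // ler_wpM2r // mulr_ge0.
rewrite mulrC ler_wpM2r //.
have pos : 1 <= (4 * e1) ^+ m by apply: exprn_ege1; have := e1_ge1; lra.
apply: (@le_trans _ _ (5 * (4 * e1) ^+ m)); first lra.
apply: (@le_trans _ _ ((5 * (4 * e1)) ^+ m)); last first.
  have [_ _ h _] := C_big; apply: expr_le; first by rewrite !mulr_ge0 // ltW.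
  by rewrite mulrA; lra.
rewrite [X in _ <= X]exprMn ler_wpM2r //; first lra.
by rewrite le_expr_m // ler1n.
Qed.

Let T_le2 : (n < m)%N -> T <= 2.
Proof.
move=> nm; have : n%:R / m%:R <= 1 :> R by rewrite ler_pdivrMr // mul1r ler_nat ltnW.
by rewrite /T; lra.
Qed.

Let trivial_lower k : (k <= m)%N -> (n < m)%N -> C ^- m * T `^ (k%:R / 2) <= 1.
Proof.
move=> km nm; rewrite mulrC ler_pdivrMr ?exprn_gt0 // mul1r.
apply: le_sqr; first by rewrite exprn_ge0 // ltW.
rewrite powR_half exprAC; apply: (@le_trans _ _ (T ^+ m)); first exact: ler_weXn2l.
apply: expr_le; first exact: ltW.
by apply: le_trans (T_le2 nm) _; have [_ _ _] := C_big.
Qed.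

Let T_le_rho : (m <= n)%N -> T ^+ m <= 2 ^+ m * rho.
Proof.
move=> mn; rewrite -exprMn; apply: expr_le; first exact: ltW.
have : 1 <= n%:R / m%:R :> R by rewrite ler_pdivlMr // mul1r ler_nat.
by rewrite /T; lra.
Qed.

Let L := Num.sqrt (rho * E ^+ m).

Let L0 : 0 < L. Proof. by rewrite sqrtr_gt0 mulr_gt0 // exprn_gt0. Qed.

Let L2 : L ^+ 2 = rho * E ^+ m.
Proof. by rewrite sqr_sqrtr // mulr_ge0 ?exprn_ge0 // ltW. Qed.

Let exists_weight : exists v : 'I_n -> R[i],
  [/\ q v < 1, forall i, v i != 0 & forall z, q z < 1 ->
     \sum_(a in tetrahedral n m) (cabs (monom a z) / cabs (monom a v)) ^+ 2 <= L ^+ 2].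
Proof.
have [v [v1 v0 vsum]] := exists_dominating_point q_norm (Xn_two_convex X_lattice X_convex) n0.
exists v; split=> // z z1; rewrite L2 /E -expRM_natl mulrC [m%:R * _]mulrC mulrC.
apply: le_trans (sum_tetrahedral_le n0 m0 (fun i => sqr_ge0 _) (vsum z z1)).
rewrite le_eqVlt; apply/orP; left; apply/eqP; apply: eq_bigr => a _.
rewrite !cabs_monom -prodf_div -prodrXl; apply: eq_bigr => i _.
by rewrite -expr_div_n exprAC.
Qed.

(** For [m <= n], [rho] is at most the number of tetrahedral monomials, hence at most
    [4 * 2 ^+ m * L * K]; as [L] is [sqrt rho] up to an exponential factor, [K] is at least of order
    [sqrt rho]. *)
Lemma proj_const_lower : C ^- m * T `^ (m%:R / 2) <= proj_const nX J n m.
Proof.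
apply: (proj_const_ge X_lattice J_deg J_neq0) => P K K1 Plin Prange Pfix Ple.
have [nm|mn] := ltnP n m.
  exact: le_trans (trivial_lower (leqnn m) nm) K1.
have [v [v1 v0 vL]] := exists_weight.
have := card_le_projection_bound q_norm Plin Prange Pfix Ple
  (@index_finset_deg J n m J_deg) v1 v0 (le_trans ler01 K1) L0 (tetrahedral_sub n J_LambdaT) vL.
have := card_tetrahedral_ge R mn m0; rewrite -/rho => /le_trans h /h {h} rho_le.
have A0 : 0 < 4 * 2 ^+ m * L by rewrite !mulr_gt0 ?exprn_gt0.
rewrite -(ler_pM2l A0); apply: le_trans rho_le.
rewrite mulrA mulrAC ler_pdivrMr ?exprn_gt0 //.
apply: le_sqr; first by rewrite mulr_ge0 ?exprn_ge0 // ltW.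
have AE : (4 * 2 ^+ m * L) ^+ 2 = 16 * 4 ^+ m * (rho * E ^+ m).
  rewrite -L2 [LHS]exprMn exprMn -exprM mulnC exprM.
  by congr (_ * _ ^+ m * _); ring.
rewrite exprMn powR_half AE [(rho * _) ^+ 2]exprMn [C ^+ m ^+ 2]exprAC.
apply: (@le_trans _ _ (16 * 4 ^+ m * (rho * E ^+ m) * (2 ^+ m * rho))).
  by rewrite ler_wpM2l ?T_le_rho // !mulr_ge0 ?exprn_ge0 // ltW.
have -> : 16 * 4 ^+ m * (rho * E ^+ m) * (2 ^+ m * rho)
    = rho ^+ 2 * (16 * (8 * E) ^+ m).
  by rewrite (_ : 8 * E = 4 * 2 * E); [rewrite !exprMn; ring | ring].
rewrite ler_wpM2l ?sqr_ge0 //.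
apply: (@le_trans _ _ ((128 * E) ^+ m)); last first.
  by have [h _ _ _] := C_big; apply: expr_le h; rewrite mulr_ge0 // ltW.
rewrite (_ : 128 * E = 16 * (8 * E)); last by ring.
rewrite [X in _ <= X]exprMn ler_wpM2r ?exprn_ge0 ?mulr_ge0 ?(ltW E0) //.
by rewrite le_expr_m // ler1n.
Qed.

Let chi_mon_ge_tetrahedral :
  rho <= chi_mon nX J n m * (Num.sqrt (n%:R * 2 ^+ m.+1) * L) \/ (n < m)%N.
Proof.
have [nm|mn] := ltnP n m; [by right | left].
have [v [v1 v0 vL]] := exists_weight.
have mv0 (b : MI n m) : monom b v != 0.
  by rewrite /monom prodf_seq_neq0; apply/allP => i _; rewrite expf_neq0.
have tdeg a : a \in tetrahedral n m -> (mdeg a <= m)%N by move=> /tetrahedralP[_ ->].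
have [eps [eps1 flat]] := exists_flat_polynomial R n0 tdeg.
(* Multiplication by the inverses of [eps] leaves [sum (z / v)^a], whose value at [v] is the number
   of tetrahedral monomials. *)
pose c (a : MI n m) : R[i] := if a \in tetrahedral n m then eps a / monom a v else 0.
have eps0 a : eps a != 0 by rewrite -cabs_eq0 eps1 oner_eq0.
have cJ : inPJ J c.
  apply/inPJ_supported => a aS; rewrite /c; case: ifP => // at'.
  by rewrite (fintype.subsetP (tetrahedral_sub n J_LambdaT)) in aS.
set B := Num.sqrt _.
have B0 : 0 < B by rewrite sqrtr_gt0 mulr_gt0 ?exprn_gt0.
have card_ge := card_tetrahedral_ge R mn m0; rewrite -/rho in card_ge.
have c_le : pnorm nX c <= B * L.
  apply: supnorm_le => // z z1; pose y i := z i / v i.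
  have yE (a : MI n m) : monom a y = monom a z / monom a v.
    by rewrite /monom -prodf_div; apply: eq_bigr => i _; rewrite expr_div_n.
  have -> : peval c z = \sum_(a in tetrahedral n m) eps a * monom a y.
    rewrite [RHS]big_mkcond; apply: eq_bigr => a _; rewrite /c; case: ifP => _.
      by rewrite yE; ring.
    by rewrite mul0r.
  apply: le_sqr; first by rewrite mulr_ge0 // ltW.
  apply: le_trans (flat y) _.
  rewrite exprMn sqr_sqrtr ?mulr_ge0 ?exprn_ge0 // ler_wpM2l ?mulr_ge0 ?exprn_ge0 //.
  apply: le_trans (vL z z1); apply: ler_sum => a _.
  by rewrite yE cabsM cabsV.
have c_gt0 : 0 < pnorm nX c.
  have /card_gt0P[a at'] : (0 < #|tetrahedral n m|)%N.
    by rewrite -(ltr0n R); apply: lt_le_trans card_ge.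
  apply: (supnorm_gt0 q_norm (b := a)).
  by rewrite /c at' mulf_neq0 // invr_eq0.
have inv1 a : cabs (eps a)^-1 <= 1 by rewrite cabsV eps1 invr1.
have := ratio_le_chi_mon X_lattice J_deg cJ inv1 c_gt0.
rewrite ler_pdivrMr // => h.
have chi0 : 0 <= chi_mon nX J n m.
  exact: le_trans ler01 (chi_mon_ge1 X_lattice J_deg J_neq0).
apply: le_trans (ler_wpM2l chi0 c_le); apply: le_trans h.
apply: le_trans card_ge _.
have := peval_le_supnorm q_norm (fun a => (eps a)^-1 * c a) v1.
apply: le_trans; rewrite -(@cabs_nat R) le_eqVlt; apply/orP; left; apply/eqP.
congr cabs; rewrite -sum1_card natr_sum big_mkcond; apply: eq_bigr => a _.
rewrite /c; case: ifP => _; last by rewrite mulr0 mul0r.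
by rewrite mulrA mulVf // mul1r mulVf.
Qed.

Lemma chi_mon_lower : C ^- m * T `^ (m.-1%:R / 2) <= chi_mon nX J n m.
Proof.
have chi1 := chi_mon_ge1 X_lattice J_deg J_neq0.
have chi0 : 0 <= chi_mon nX J n m by apply: le_trans chi1.
have [nm|mn] := ltnP n m.
  exact: le_trans (trivial_lower (leq_pred m) nm) chi1.
case: chi_mon_ge_tetrahedral => [|nm]; last by rewrite ltnNge mn in nm.
set B := Num.sqrt _ => rho_le.
have B0 : 0 < B by rewrite sqrtr_gt0 mulr_gt0 ?exprn_gt0.
have A0 : 0 < B * L by rewrite mulr_gt0.
rewrite -(ler_pM2r A0); apply: le_trans rho_le.
rewrite -mulrA mulrC ler_pdivrMr ?exprn_gt0 //.
apply: le_sqr; first by rewrite mulr_ge0 ?exprn_ge0 // ltW.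
have AE : (B * L) ^+ 2 = n%:R * 2 ^+ m.+1 * (rho * E ^+ m).
  by rewrite -L2 exprMn sqr_sqrtr // mulr_ge0 ?exprn_ge0.
rewrite exprMn powR_half AE [(rho * _) ^+ 2]exprMn [C ^+ m ^+ 2]exprAC.
(* The factor [n] of the random polynomial is traded for one power of [T], and [m <= 2 ^+ m] is
   absorbed into [C]; this leaves [T ^+ m.-1]. *)
have nT : n%:R <= m%:R * T by rewrite /T mulrDr mulr1 mulrCA divff // mulr1 lerDr.
have m2 : m%:R <= 2 ^+ m :> R by rewrite -natrX ler_nat ltnW // ltn_expl.
have TT : T ^+ m.-1 * n%:R <= 2 ^+ m * (2 ^+ m * rho).
  apply: (@le_trans _ _ (m%:R * T ^+ m)).
    rewrite -[in X in _ <= X](prednK m0) exprS [T * _]mulrC mulrCA.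
    by rewrite prednK // ler_wpM2l ?exprn_ge0 // ltW.
  by rewrite ler_pM ?exprn_ge0 ?T_le_rho // ltW.
apply: (@le_trans _ _ ((2 ^+ m * (2 ^+ m * rho)) * (2 ^+ m.+1 * (rho * E ^+ m)))).
  have -> : T ^+ m.-1 * (n%:R * 2 ^+ m.+1 * (rho * E ^+ m))
     = (T ^+ m.-1 * n%:R) * (2 ^+ m.+1 * (rho * E ^+ m)) by ring.
  by rewrite ler_wpM2r // !mulr_ge0 ?exprn_ge0 // ltW.
have -> : (2 ^+ m * (2 ^+ m * rho)) * (2 ^+ m.+1 * (rho * E ^+ m))
    = rho ^+ 2 * (2 * (8 * E) ^+ m).
  by rewrite (_ : 8 * E = 2 * 2 * 2 * E); [rewrite !exprMn exprS; ring | ring].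
rewrite ler_wpM2l ?sqr_ge0 //.
apply: (@le_trans _ _ ((2 * (8 * E)) ^+ m)).
  rewrite [X in _ <= X]exprMn ler_wpM2r ?exprn_ge0 ?mulr_ge0 ?(ltW E0) //.
  by rewrite le_expr_m // ler1n.
apply: expr_le; first by rewrite !mulr_ge0 // ltW.
by have [h _ _ _] := C_big; have := E0; lra.
Qed.

End Bounds.

Unset Implicit Arguments.
Theorem theorem2p16 (R : realType) (M : R) :
  exists2 C : R, 0 < C &
  forall (Xm : set (cseq R)) (nX : cseq R -> R),
    is_banach_seq_lattice Xm nX -> two_convex Xm nX M ->
  forall J : nat -> set mindex,
    (forall m, index_set (J m)) -> (forall m, deg_at_most (J m) m) ->
  forall n m : nat, (0 < n)%N -> (0 < m)%N ->
    LambdaT m `<=` J m ->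
    (exists a, J m a /\ forall k, (n <= k)%N -> a k = 0%N) ->
    (C ^- m * (1 + n%:R / m%:R) `^ (m%:R / 2) <= proj_const nX (J m) n m
     <= C ^+ m * (1 + n%:R / m%:R) `^ (m%:R / 2)) /\
    (C ^- m * (1 + n%:R / m%:R) `^ ((m%:R - 1) / 2) <= chi_mon nX (J m) n m
     <= C ^+ m * (1 + n%:R / m%:R) `^ ((m%:R - 1) / 2)).

Proof.
exists (32 * expR 1 * expR (24 * M ^+ 2)); first by rewrite !mulr_gt0 ?expR_gt0.
move=> Xm nX X_lattice X_convex J _ J_deg n m n0 m0 J_LambdaT J_neq0.
have -> : (m%:R - 1 : R) = m.-1%:R by rewrite -[in LHS](prednK m0) -natr1 addrK.
split; apply/andP; split.
- exact: (proj_const_lower (Xm := Xm)).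
- exact: (proj_const_upper M (Xm := Xm)).
- exact: (chi_mon_lower (Xm := Xm)).
- exact: (chi_mon_upper M (Xm := Xm)).
Qed.
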